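(* Let $\nu$ be the middle-thirds Cantor measure affinely rescaled to $[0.5,2.0]$ and let $L(s)=\sum_{n\ge1}\hat\nu(n)n^{-s}$, continued to an entire function. Then $$\mu_L(\tfrac12)\le\tfrac18.$$
   Context: $\nu$ is the probability measure on $[0.5,2.0]\subset(0,2\pi)$ obtained from the middle-thirds Cantor measure by an affine map; $\hat\nu(n)=\int e^{in\theta}\,d\nu(\theta)$. The entire continuation is $L(s)=\int F(\theta,s)\,d\nu(\theta)$ with $F(\theta,s)=\sum_{n\ge1}e^{in\theta}n^{-s}$ (continued analytically). The order function is $\mu_L(\sigma)=\inf\{\beta\ge0:L(\sigma+it)=O(|t|^\beta)\text{ as }|t|\to\infty\}$. *)

(* Defs.v *)
(* MathComp-Analysis, over an arbitrary R : realType; the complex numbers are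
   R[i] from mathcomp-real-closed, and R[i]^o carries the topology of the modulus. *)
From HB Require Import structures.
From mathcomp Require Import all_boot all_order all_algebra.
From mathcomp Require Import all_classical all_reals all_analysis.
From mathcomp Require Import complex.
Set Implicit Arguments.
Unset Strict Implicit.
Unset Printing Implicit Defensive.
Import Order.TTheory GRing.Theory Num.Theory.
Import numFieldNormedType.Exports.
Local Open Scope classical_set_scope.
Local Open Scope ring_scope.
Local Open Scope complex_scope.

(* The middle-thirds Cantor measure is the self-similar measure of the two maps
   generating the Cantor set, with equal weights: the unique Borel probability
   measure with mu = 1/2 (x |-> x/3)_* mu + 1/2 (x |-> x/3 + 2/3)_* mu. *)
Definition is_cantor_measure (R : realType)
    (mu : probability (measurableTypeR R) R) : Prop :=
  forall A : set (measurableTypeR R), measurable A ->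
    (mu A = (1 / 2)%:E * mu [set x : R | A (x / 3)%R]
          + (1 / 2)%:E * mu [set x : R | A (x / 3 + 2 / 3)%R])%E.

(* The affine map of [0, 1] onto [0.5, 2.0]. *)
Definition rescale (R : realType) (x : measurableTypeR R) : measurableTypeR R :=
  1 / 2 + 3 / 2 * x.

Lemma measurable_rescale (R : realType) : measurable_fun setT (@rescale R).
Proof. by rewrite /rescale; apply: measurable_realfun.measurable_funD. Qed.

HB.instance Definition _ (R : realType) :=
  isMeasurableFun.Build _ _ _ _ (@rescale R) (@measurable_rescale R).

Definition rescaled_measure (R : realType)
    (mu : probability (measurableTypeR R) R) :
    probability (measurableTypeR R) R :=
  distribution mu (@rescale R).

(* \int e^(i n theta) d nu(theta), integrated componentwise. *)
Definition fourier_coef (R : realType)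
    (nu : probability (measurableTypeR R) R) (n : nat) : R[i] :=
  (\int[nu]_(x in setT) cos (n%:R * x))
    +i* (\int[nu]_(x in setT) sin (n%:R * x)).

Definition cexp (R : realType) (z : R[i]) : R[i] :=
  (expR (complex.Re z) * cos (complex.Im z))
    +i* (expR (complex.Re z) * sin (complex.Im z)).

(* n ^ (- s); only meaningful for n >= 1. *)
Definition npow_opp (R : realType) (n : nat) (s : R[i]) : R[i] :=
  cexp (- s * (ln (n%:R : R))%:C).

(* Complex differentiability at every point: R[i]^o is the normed space R[i]
   over the field R[i] itself. *)
Definition entire (R : realType) (f : R[i] -> R[i]) : Prop :=
  forall z : R[i], derivable (f : R[i]^o -> R[i]^o) z 1.

(* L is entire and L(s) = \sum_(n >= 1) a n * n ^ (- s) for Re s > 1. *)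
Definition entire_continuation (R : realType) (a : nat -> R[i])
    (L : R[i] -> R[i]) : Prop :=
  entire L /\
  forall s : R[i], 1 < complex.Re s ->
    series (fun k => a k.+1 * npow_opp k.+1 s : R[i]^o) @ \oo --> (L s : R[i]^o).

(* The infimum is taken in \bar R: it is +oo when no exponent is admissible. *)
Definition order_function (R : realType) (L : R[i] -> R[i]) (sigma : R) : \bar R :=
  ereal_inf [set b%:E | b in [set b : R | 0 <= b /\
    exists C T : R, forall t : R, T <= `|t| ->
      Normc.normc (L (sigma +i* t)) <= C * `|t| `^ b]].

(* Main.v *)
From HB Require Import structures.
Require Import Defs.
From mathcomp Require Import all_boot all_order all_algebra.
From mathcomp Require Import all_classical all_reals all_analysis.
From mathcomp Require Import measurable_realfun complex ring lra.
Set Implicit Arguments.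
Unset Strict Implicit.
Unset Printing Implicit Defensive.
Import Order.TTheory GRing.Theory Num.Theory.
Import numFieldNormedType.Exports.
Local Open Scope classical_set_scope.
Local Open Scope ring_scope.

(** Write a(n) for the n-th Fourier coefficient of the rescaled Cantor measure
    and L for the sum of the a(n) n^(-s).  At s = 1/2 + it the series is cut at a
    power N of 3 comparable with |t|; the head is bounded by absolute values and
    the tail by summation by parts.

    Head.  Self-similarity of the measure makes |a(n)| a product of cosines,
    one for each triadic scale, |cos (n / (2 * 3^j))|.  Each integer n is
    compared with a point of the lattice 2 pi Z; on that lattice the products
    are periodic, and summing over all residues two scales at a time costs a
    factor 35/9 up to a summable error ([sum_nine_cos_le], [grid_sum_step]).
    As 35/9 < 3^(5/4), the sum of |a(n)| for n < 3^K is O(3^(5K/8))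
    ([sum_coef_abs_growth]), hence the sum of |a(n)| n^(-1/2) is O(3^(K/8)),
    which is O(|t|^(1/8)) ([weighted_sum_growth]).  The single-scale bound 2 for
    the sum of three cosines would only give the exponent
    log 2 / log 3 - 1/2 > 1/8.

    Tail.  The support of the measure is in [1/2, 2], at a positive distance
    from 2 pi Z.  For each angle in the support and n larger than a constant
    times |s|, the ratio of consecutive terms of the series stays away from 1
    and varies slowly, so that the argument of Kusmin and Landau bounds the sum
    beyond N by a constant ([wave_sum_le], [dirichlet_tail_le]).

    Continuation.  For the same reason a(n) can be written, for every k, as a
    k-fold difference of a bounded sequence, obtained by integrating
    e^(i n theta) / (e^(-i theta) - 1)^k.  After k Abel summations the series
    involves the k-th differences of n^(-s), of size n^(-Re s - k), and converges
    as soon as Re s + k > 1.  The values for different k agree because the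
    boundary terms tend to 0, and holomorphy follows from a quadratic bound,
    summable in n, on the Taylor remainder in s of the same differences
    ([fdiff_cpow_rem_le], [continuation_entire]).  For Re s > 0 the plain partial
    sums still converge to the continuation ([continuation_cvg]), which is what
    connects it to the head and the tail above. *)

Local Open Scope complex_scope.

(** * Complex numbers and complex-valued functions of a real variable *)

Notation modc := (@Normc.normc _).
Notation Rep := (@complex.Re _).
Notation Imp := (@complex.Im _).

Lemma cReD (R : realType) (x y : R[i]) : Rep (x + y) = Rep x + Rep y.
Proof. by case: x; case: y. Qed.
Lemma cImD (R : realType) (x y : R[i]) : Imp (x + y) = Imp x + Imp y.
Proof. by case: x; case: y. Qed.
Lemma cReN (R : realType) (x : R[i]) : Rep (- x) = - Rep x.
Proof. by case: x. Qed.
Lemma cImN (R : realType) (x : R[i]) : Imp (- x) = - Imp x.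
Proof. by case: x. Qed.
Lemma cReM (R : realType) (x y : R[i]) :
  Rep (x * y) = Rep x * Rep y - Imp x * Imp y.
Proof. by case: x; case: y. Qed.
Lemma cImM (R : realType) (x y : R[i]) :
  Imp (x * y) = Rep x * Imp y + Imp x * Rep y.
Proof. by case: x; case: y. Qed.
Lemma complex_ext (R : realType) (x y : R[i]) :
  Rep x = Rep y -> Imp x = Imp y -> x = y.
Proof. by case: x; case: y => /= ? ? ? ? -> ->. Qed.

Definition cReImE := (cReD, cImD, cReN, cImN, cReM, cImM).

Lemma modc_ge0 (R : realType) (z : R[i]) : 0 <= modc z.
Proof. by case: z => a b; apply: sqrtr_ge0. Qed.

Lemma modcM (R : realType) (x y : R[i]) : modc (x * y) = modc x * modc y.
Proof. exact: Normc.normcM. Qed.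

Lemma modcD (R : realType) (x y : R[i]) : modc (x + y) <= modc x + modc y.
Proof. exact: le_normcD. Qed.

Lemma modcN (R : realType) (x : R[i]) : modc (- x) = modc x.
Proof. exact: normcN. Qed.

Lemma modc0 (R : realType) : modc (0 : R[i]) = 0.
Proof. exact: Normc.normc0. Qed.

Lemma modc1 (R : realType) : modc (1 : R[i]) = 1.
Proof. exact: Normc.normc1. Qed.

Lemma modcV (R : realType) (x : R[i]) : modc x^-1 = (modc x)^-1.
Proof. exact: Normc.normcV. Qed.

Lemma modcX (R : realType) (x : R[i]) n : modc (x ^+ n) = modc x ^+ n.
Proof.
by elim: n => [|n IH]; rewrite ?expr0 ?modc1// !exprS modcM IH.
Qed.

Lemma modcB (R : realType) (x y : R[i]) : modc (x - y) <= modc x + modc y.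
Proof. by rewrite -(modcN y) modcD. Qed.

Lemma modcBC (R : realType) (x y : R[i]) : modc (x - y) = modc (y - x).
Proof. by rewrite -modcN opprB. Qed.

Lemma modc_tri (R : realType) (x y : R[i]) : modc x - modc y <= modc (x - y).
Proof. by rewrite lerBlDr -{1}(subrK y x) modcD. Qed.

Lemma modc_real (R : realType) (x : R) : modc x%:C = `|x|.
Proof. by rewrite /Normc.normc /= expr0n /= addr0 sqrtr_sqr. Qed.

Lemma abs_Re_le (R : realType) (z : R[i]) : `|Rep z| <= modc z.
Proof.
case: z => a b; rewrite /Normc.normc/= -sqrtr_sqr ler_sqrt ?lerDl ?sqr_ge0//.
by rewrite addr_ge0// sqr_ge0.
Qed.

Lemma abs_Im_le (R : realType) (z : R[i]) : `|Imp z| <= modc z.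
Proof.
case: z => a b; rewrite /Normc.normc/= -sqrtr_sqr ler_sqrt ?lerDr ?sqr_ge0//.
by rewrite addr_ge0// sqr_ge0.
Qed.

Lemma modc_le_ReIm (R : realType) (z : R[i]) : modc z <= `|Rep z| + `|Imp z|.
Proof.
case: z => a b; rewrite /Normc.normc/=.
rewrite -[leRHS]ger0_norm ?addr_ge0// -sqrtr_sqr ler_sqrt ?sqr_ge0//.
rewrite -[a ^+ 2]real_normK ?num_real// -[b ^+ 2]real_normK ?num_real//.
by rewrite sqrrD addrAC lerDl mulrn_wge0// mulr_ge0.
Qed.

Lemma modc_sum (R : realType) (I : Type) (r : seq I) (P : pred I)
  (f : I -> R[i]) :
  modc (\sum_(i <- r | P i) f i) <= \sum_(i <- r | P i) modc (f i).
Proof.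
apply: (big_ind2 (fun (x : R[i]) (y : R) => modc x <= y)) => //.
- by rewrite modc0.
- by move=> x1 x2 y1 y2 h1 h2; rewrite (le_trans (modcD _ _))// lerD.
Qed.

Lemma cexpD (R : realType) (a b : R[i]) : cexp (a + b) = cexp a * cexp b.
Proof.
apply: complex_ext; rewrite /cexp !cReImE/= expRD ?cosD ?sinD; ring.
Qed.

Lemma cexp0 (R : realType) : cexp (0 : R[i]) = 1.
Proof. by rewrite /cexp /= expR0 cos0 sin0 mulr1 mulr0. Qed.

Lemma modc_cexp (R : realType) (z : R[i]) : modc (cexp z) = expR (Rep z).
Proof.
rewrite /cexp /Normc.normc !exprMn -mulrDr cos2Dsin2 mulr1 sqrtr_sqr.
by rewrite ger0_norm// expR_ge0.
Qed.

(** Componentwise, since the normed space R[i] has R[i] for scalars and the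
    variable here is real. *)
Definition has_cderiv (R : realType) (f : R -> R[i]) (x : R) (d : R[i]) :=
  is_derive x 1 (fun y => Rep (f y)) (Rep d) /\
  is_derive x 1 (fun y => Imp (f y)) (Imp d).

Lemma has_derive_eq (R : realType) (f : R -> R) (x d e : R) :
  is_derive x 1 f d -> d = e -> is_derive x 1 f e.
Proof. by move=> + <-. Qed.

Lemma has_cderivD (R : realType) (f g : R -> R[i]) x df dg :
  has_cderiv f x df -> has_cderiv g x dg ->
  has_cderiv (fun y => f y + g y) x (df + dg).
Proof.
move=> [f1 f2] [g1 g2]; split; rewrite cReImE.
- under eq_fun do rewrite cReD. exact: is_deriveD.
- under eq_fun do rewrite cImD. exact: is_deriveD.
Qed.

Lemma has_cderivN (R : realType) (f : R -> R[i]) x df :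
  has_cderiv f x df -> has_cderiv (fun y => - f y) x (- df).
Proof.
move=> [f1 f2]; split; rewrite cReImE.
- under eq_fun do rewrite cReN. exact: is_deriveN.
- under eq_fun do rewrite cImN. exact: is_deriveN.
Qed.

Lemma has_cderiv_cst (R : realType) (c : R[i]) (x : R) :
  has_cderiv (fun=> c) x 0.
Proof. by split; exact: is_derive_cst. Qed.

Lemma has_cderiv_eq (R : realType) (f : R -> R[i]) x d e :
  has_cderiv f x d -> d = e -> has_cderiv f x e.
Proof. by move=> + <-. Qed.

Lemma has_cderivM (R : realType) (f g : R -> R[i]) x df dg :
  has_cderiv f x df -> has_cderiv g x dg ->
  has_cderiv (fun y => f y * g y) x (df * g x + f x * dg).
Proof.
move=> [f1 f2] [g1 g2]; split.
- under eq_fun do rewrite cReM.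
  apply: is_derive_eq; rewrite /= !cReImE /GRing.scale/=; ring.
- under eq_fun do rewrite cImM.
  apply: is_derive_eq; rewrite /= !cReImE /GRing.scale/=; ring.
Qed.

Lemma has_cderiv_real (R : realType) (g : R -> R) (x dg : R) :
  is_derive x 1 g dg -> has_cderiv (fun y => (g y)%:C) x dg%:C.
Proof. by move=> h; split => //=; exact: is_derive_cst. Qed.

Lemma has_cderiv_cexp (R : realType) (w : R[i]) (g : R -> R) (x dg : R) :
  is_derive x 1 g dg ->
  has_cderiv (fun y => cexp (w * (g y)%:C)) x
    (w * dg%:C * cexp (w * (g x)%:C)).
Proof.
case: w => a b h.
have h1 (c : R) : is_derive x 1 (fun y => c * g y - 0) (c * dg).
  under eq_fun do rewrite subr0; apply: is_deriveZ.
have h2 (c : R) : is_derive x 1 (fun y => a * 0 + c * g y) (c * dg).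
  under eq_fun do rewrite mulr0 add0r; apply: is_deriveZ.
have he (c : R) : is_derive x 1 (fun y => expR (c * g y - b * 0))
    ((c * dg) * expR (c * g x)).
  under eq_fun do rewrite mulr0.
  have := @is_derive1_comp _ expR (fun y => c * g y - 0) x _ _ _ (h1 c).
  by move=> /(_ _ (is_derive_expR _)); rewrite subr0 mulrC.
have hs (c : R) : is_derive x 1 (fun y => sin (a * 0 + c * g y))
    ((c * dg) * cos (c * g x)).
  have := @is_derive1_comp _ sin (fun y => a * 0 + c * g y) x _ _ _ (h2 c).
  by move=> /(_ _ (is_derive_sin _)); rewrite mulr0 add0r mulrC.
have hc (c : R) : is_derive x 1 (fun y => cos (a * 0 + c * g y))
    (- (c * dg) * sin (c * g x)).
  have := @is_derive1_comp _ cos (fun y => a * 0 + c * g y) x _ _ _ (h2 c).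
  by move=> /(_ _ (is_derive_cos _)); rewrite mulr0 add0r mulrC mulrN mulNr.
rewrite /cexp; split => /=.
- have h3 := is_deriveM (he a) (hc b).
  apply: (has_derive_eq h3).
  by rewrite /GRing.scale/= !mulr0 ?subr0 ?add0r ?addr0; ring.
- have h3 := is_deriveM (he a) (hs b).
  apply: (has_derive_eq h3).
  by rewrite /GRing.scale/= !mulr0 ?subr0 ?add0r ?addr0; ring.
Qed.

Lemma has_cderiv_shift (R : realType) (f : R -> R[i]) (x k : R) d :
  has_cderiv f (x + k) d -> has_cderiv (fun y => f (y + k)) x d.
Proof.
have hk : is_derive x 1 (fun y => y + k) 1.
  by apply: is_derive_eq; rewrite addr0.
move=> [f1 f2]; split.
- have := @is_derive1_comp _ _ (fun y => y + k) x _ _ f1 hk.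
  by rewrite mulr1.
- have := @is_derive1_comp _ _ (fun y => y + k) x _ _ f2 hk.
  by rewrite mulr1.
Qed.

Lemma real_increment_le (R : realType) (f f' : R -> R) (a b B : R) :
  a <= b -> (forall x, a <= x <= b -> is_derive x 1 f (f' x)) ->
  (forall x, a <= x <= b -> `|f' x| <= B) -> `|f b - f a| <= B * (b - a).
Proof.
move=> ab df fB.
have [||c cab ->] := @MVT_segment _ f f' a b ab.
- by move=> x; rewrite in_itv/= => /andP[/ltW ax /ltW xb]; apply: df; rewrite ax.
- apply: continuous_in_subspaceT => x; rewrite inE/= in_itv/= => xab.
  by apply: differentiable_continuous; apply/derivable1_diffP; case: (df x xab).
rewrite normrM (ger0_norm (_ : 0 <= b - a)) ?subr_ge0//.
by rewrite ler_wpM2r ?subr_ge0// fB//; move: cab; rewrite in_itv.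
Qed.

(** The mean value theorem fails for complex values, but applied to the two
    components it costs only a factor 2. *)
Lemma cincrement_le (R : realType) (f f' : R -> R[i]) (a b B : R) :
  a <= b -> (forall x, a <= x <= b -> has_cderiv f x (f' x)) ->
  (forall x, a <= x <= b -> modc (f' x) <= B) ->
  modc (f b - f a) <= 2 * B * (b - a).
Proof.
move=> ab df fB; apply: (le_trans (modc_le_ReIm _)).
rewrite !cReImE -mulrA mulrDl !mul1r; apply: lerD.
- apply: (@real_increment_le _ (fun y => Rep (f y)) (fun y => Rep (f' y))) => //.
    by move=> x /df [].
  by move=> x /fB; apply: le_trans; apply: abs_Re_le.
- apply: (@real_increment_le _ (fun y => Imp (f y)) (fun y => Imp (f' y))) => //.
    by move=> x /df [].
  by move=> x /fB; apply: le_trans; apply: abs_Im_le.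
Qed.

(** The hypothesis on B is stated along the segment so that it can be met with
    B = 1 when [Re w <= 0]. *)
Lemma cexpB1_le (R : realType) (w : R[i]) (B u : R) :
  0 <= u -> (forall v, 0 <= v <= u -> expR (v * Rep w) <= B) ->
  modc (cexp (w * u%:C) - 1) <= 2 * (modc w * B) * u.
Proof.
move=> u0 hB.
have := @cincrement_le _ (fun v => cexp (w * v%:C))
  (fun v => w * cexp (w * v%:C)) 0 u (modc w * B) u0.
have -> : (0 : R)%:C = 0 :> R[i] by [].
rewrite mulr0 cexp0 subr0; apply.
- move=> x _; apply: has_cderiv_eq.
    exact: (@has_cderiv_cexp _ w (fun y => y) x 1).
  by rewrite mulr1.
- move=> x xu; rewrite modcM ler_wpM2l ?modc_ge0// modc_cexp cReImE/=.
  by rewrite mulr0 subr0 mulrC; apply: hB.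
Qed.

Lemma cexpB1_le_expR (R : realType) (w : R[i]) :
  modc (cexp w - 1) <= 2 * modc w * expR (modc w).
Proof.
have := @cexpB1_le _ w (expR (modc w)) 1 ler01.
have -> : (1 : R)%:C = 1 :> R[i] by [].
rewrite !mulr1 mulrA; apply => v /andP[v0 v1].
rewrite ler_expR (le_trans (ler_norm _))// normrM ger0_norm//.
by rewrite -[leRHS]mul1r ler_pM// abs_Re_le.
Qed.

Lemma cexpB1B_le_expR (R : realType) (w : R[i]) :
  modc (cexp w - 1 - w) <= 4 * modc w ^+ 2 * expR (modc w).
Proof.
have := @cincrement_le _ (fun v => cexp (w * v%:C) - w * v%:C)
  (fun v => w * (cexp (w * v%:C) - 1)) 0 1
  (modc w * (2 * modc w * expR (modc w))) ler01.
have -> : (1 : R)%:C = 1 :> R[i] by [].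
have -> : (0 : R)%:C = 0 :> R[i] by [].
rewrite !mulr0 !mulr1 cexp0 !subr0.
rewrite (_ : cexp w - w - 1 = cexp w - 1 - w); last by rewrite addrAC.
rewrite (_ : 4 * modc w ^+ 2 * _ =
  2 * (modc w * (2 * modc w * expR (modc w)))); last by ring.
move=> H; rewrite -[leRHS]mulr1; apply: H.
- move=> x _; apply: has_cderiv_eq.
    apply: has_cderivD.
      exact: (@has_cderiv_cexp _ w (fun y => y) x 1).
    apply: has_cderivN; apply: has_cderivM; first exact: has_cderiv_cst.
    by apply: (has_cderiv_real (dg := 1)).
  by rewrite mulr1; ring.
- move=> x /andP[x0 x1]; rewrite modcM ler_wpM2l ?modc_ge0//.
  apply: (le_trans (cexpB1_le_expR _)).
  have wx : modc (w * x%:C) <= modc w.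
    by rewrite modcM modc_real ger0_norm// ler_piMr// modc_ge0.
  by rewrite ler_pM ?mulr_ge0 ?modc_ge0 ?expR_ge0 ?ler_expR// ler_wpM2l.
Qed.

(** * Iterated differences of complex powers *)

(** The power x ^ (- s), for x > 0. *)
Definition cpow (R : realType) (s : R[i]) (x : R) : R[i] :=
  cexp (- s * (ln x)%:C).

(** The power x ^ p, for x > 0. *)
Definition rpow (R : realType) (p x : R) : R := expR (p * ln x).

Definition fdiff (R : realType) (f : R -> R[i]) : R -> R[i] :=
  fun x => f (x + 1) - f x.

Lemma rpow_ge0 (R : realType) (p x : R) : 0 <= rpow p x.
Proof. exact: expR_ge0. Qed.

Lemma rpowD (R : realType) (p q x : R) : rpow (p + q) x = rpow p x * rpow q x.
Proof. by rewrite /rpow mulrDl expRD. Qed.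

Lemma ler_rpow (R : realType) (p q x : R) :
  1 <= x -> p <= q -> rpow p x <= rpow q x.
Proof. by move=> x1 pq; rewrite ler_expR ler_wpM2r// ln_ge0. Qed.

Lemma rpow1 (R : realType) (x : R) : 0 < x -> rpow 1 x = x.
Proof. by move=> x0; rewrite /rpow mul1r lnK// posrE. Qed.

Lemma modc_cpow (R : realType) (s : R[i]) (x : R) :
  modc (cpow s x) = rpow (- Rep s) x.
Proof. by rewrite /cpow modc_cexp /rpow !cReImE /= mulr0 subr0. Qed.

Lemma cpowD (R : realType) (s h : R[i]) (x : R) :
  cpow (s + h) x = cpow s x * cexp (- h * (ln x)%:C).
Proof. by rewrite /cpow opprD mulrDl cexpD. Qed.

Lemma rpow_near (R : realType) (p x y : R) : 1 <= x -> x <= y <= x + 1 ->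
  rpow p y <= expR `|p| * rpow p x.
Proof.
move=> x1 /andP[xy yx]; have x0 : 0 < x by apply: lt_le_trans x1.
rewrite /rpow -expRD ler_expR -lerBlDr -mulrBr.
apply: (le_trans (ler_norm _)); rewrite normrM ler_piMr//.
have y0 : 0 < y by apply: lt_le_trans xy.
rewrite ger0_norm ?subr_ge0 ?ler_ln ?posrE// -ln_div ?posrE//.
apply: (le_trans (y := y / x - 1)).
  have := @le_ln1Dx _ (y / x - 1).
  rewrite addrCA subrr addr0; apply.
  by rewrite ltrBrDr addrC subrr divr_gt0.
rewrite lerBlDr ler_pdivrMr//; apply: (le_trans yx).
by rewrite mulrDl mul1r lerD2l.
Qed.

Lemma iter_fdiffS (R : realType) k (f : R -> R[i]) :
  iter k.+1 (@fdiff R) f = fdiff (iter k (@fdiff R) f).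
Proof. by []. Qed.

Lemma has_cderiv_iter_fdiff (R : realType) (f f' : R -> R[i]) :
  (forall x, 1 <= x -> has_cderiv f x (f' x)) ->
  forall k x, 1 <= x ->
    has_cderiv (iter k (@fdiff R) f) x (iter k (@fdiff R) f' x).
Proof.
move=> h; elim => [|k IH] x x1 //=; first exact: h.
rewrite /fdiff; apply: has_cderivD; last by apply: has_cderivN; apply: IH.
by apply: has_cderiv_shift; apply: IH; rewrite (le_trans x1)// lerDl.
Qed.

Lemma iter_fdiff_lin (R : realType) (a b : R[i]) (f g : R -> R[i]) k :
  iter k (@fdiff R) (fun x => a * f x + b * g x) =
  (fun x => a * iter k (@fdiff R) f x + b * iter k (@fdiff R) g x).
Proof.
elim: k => [|k IH] //=; rewrite IH; apply/funext => x; rewrite /fdiff; ring.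
Qed.

Lemma iter_fdiffZ (R : realType) (a : R[i]) (f : R -> R[i]) k :
  iter k (@fdiff R) (fun x => a * f x) =
  (fun x => a * iter k (@fdiff R) f x).
Proof.
elim: k => [|k IH] //=; rewrite IH; apply/funext => x; rewrite /fdiff; ring.
Qed.

(** Differences commute with derivatives, so one mean value step trades a
    difference for a derivative at any level of iteration. *)
Lemma iter_fdiff_step (R : realType) (f f' : R -> R[i]) k (A p : R) :
  0 <= A -> (forall x, 1 <= x -> has_cderiv f x (f' x)) ->
  (forall x, 1 <= x -> modc (iter k (@fdiff R) f' x) <= A * rpow p x) ->
  forall x, 1 <= x ->
    modc (iter k.+1 (@fdiff R) f x) <= 2 * (A * expR `|p|) * rpow p x.
Proof.
move=> A0 df hb x x1; rewrite iter_fdiffS /fdiff.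
have := @cincrement_le _ (iter k (@fdiff R) f) (iter k (@fdiff R) f') x (x + 1)
  (A * (expR `|p| * rpow p x)).
rewrite [x + 1 - x]addrAC subrr add0r mulr1 !mulrA; apply.
- by rewrite lerDl.
- move=> y /andP[xy _]; apply: has_cderiv_iter_fdiff => //.
  exact: le_trans xy.
- move=> y xy; have y1 : 1 <= y by case/andP: xy => xy _; exact: le_trans xy.
  apply: (le_trans (hb y y1)); rewrite -mulrA; apply: ler_wpM2l => //.
  exact: rpow_near.
Qed.

Lemma has_cderiv_cpow (R : realType) (s : R[i]) (x : R) : 1 <= x ->
  has_cderiv (cpow s) x (- s * cpow (s + 1) x).
Proof.
move=> x1; have x0 : 0 < x by apply: lt_le_trans x1.
apply: has_cderiv_eq.
  exact: (has_cderiv_cexp (- s) (is_derive1_ln x0)).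
rewrite -mulrA; congr (_ * _).
rewrite cpowD mulrC; congr (_ * _).
rewrite mulN1r; apply: complex_ext; rewrite /cexp /= oppr0.
  by rewrite cos0 mulr1 expRN lnK// posrE.
by rewrite sin0 mulr0.
Qed.

Definition cpow_incr (R : realType) (s h : R[i]) (x : R) : R[i] :=
  cpow (s + h) x - cpow s x.

(** The Taylor remainder of order 2 of z |-> x ^ (- z) at s. *)
Definition cpow_rem (R : realType) (s h : R[i]) (x : R) : R[i] :=
  cpow (s + h) x - cpow s x + h * (ln x)%:C * cpow s x.

Lemma has_cderiv_cpow_incr (R : realType) (s h : R[i]) (x : R) : 1 <= x ->
  has_cderiv (cpow_incr s h) x
    (- s * cpow_incr (s + 1) h x + - h * cpow (s + 1 + h) x).
Proof.
move=> x1; rewrite /cpow_incr; apply: has_cderiv_eq.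
  by apply: has_cderivD; [|apply: has_cderivN]; exact: has_cderiv_cpow.
by rewrite [s + h + 1]addrAC; ring.
Qed.

Lemma has_cderiv_cpow_rem (R : realType) (s h : R[i]) (x : R) : 1 <= x ->
  has_cderiv (cpow_rem s h) x
    (- s * cpow_rem (s + 1) h x + - h * cpow_incr (s + 1) h x).
Proof.
move=> x1; have x0 : 0 < x by apply: lt_le_trans x1.
rewrite /cpow_incr /cpow_rem; apply: has_cderiv_eq.
  apply: has_cderivD.
    by apply: has_cderivD; [|apply: has_cderivN]; exact: has_cderiv_cpow.
  apply: has_cderivM; last exact: has_cderiv_cpow.
  apply: has_cderivM; first exact: has_cderiv_cst.
  by apply: has_cderiv_real; apply: is_derive1_ln.
rewrite mul0r add0r [s + h + 1]addrAC.
suff -> : cpow (s + 1) x = (x^-1)%:C * cpow s x by ring.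
rewrite cpowD mulrC; congr (_ * _).
rewrite mulN1r; apply: complex_ext; rewrite /cexp /= oppr0.
  by rewrite cos0 mulr1 expRN lnK// posrE.
by rewrite sin0 mulr0.
Qed.

Section differences_of_powers.
Context (R : realType).
Implicit Types (s h : R[i]) (x : R).

Let step_weaken (A m e e' r : R) :
  0 <= A -> 0 <= m -> 0 <= r -> e <= e' ->
  2 * (A * m * e) * r <= 2 * (A * e') * m * r.
Proof.
move=> A0 m0 r0 ee.
rewrite [leRHS](_ : _ = 2 * (A * m * e') * r); last by ring.
by rewrite ler_wpM2r// !ler_wpM2l// mulr_ge0.
Qed.

(** Each difference gains a factor 1 / x, uniformly for s in a disc. *)
Lemma fdiff_cpow_le k (S : R) : exists C, 0 <= C /\
  forall s x, modc s <= S -> 1 <= x ->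
    modc (iter k (@fdiff R) (cpow s) x) <= C * rpow (- Rep s - k%:R) x.
Proof.
elim: k S => [|k IH] S.
  exists 1; split=> // s x _ _.
  by rewrite modc_cpow mul1r subr0.
have [C [C0 hC]] := IH (S + 1).
exists (2 * (`|S| * C * expR (`|S| + k.+1%:R))); split.
  by rewrite !mulr_ge0// expR_ge0.
move=> s x sS x1.
have sS' : modc s <= `|S| by rewrite (le_trans sS)// ler_norm.
have := @iter_fdiff_step _ (cpow s) (fun y => - s * cpow (s + 1) y) k
  (`|S| * C) (- Rep s - k.+1%:R) (mulr_ge0 (normr_ge0 _) C0)
  (fun y => @has_cderiv_cpow _ s y).
move=> H; apply: (le_trans (H _ x x1)).
- move=> y y1; rewrite iter_fdiffZ modcM modcN -mulrA.
  apply: ler_pM; rewrite ?modc_ge0//.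
  have := hC (s + 1) y; rewrite cReD/=.
  rewrite (_ : - (Rep s + 1) - k%:R = - Rep s - k.+1%:R); last first.
    by rewrite -natr1; ring.
  apply => //; rewrite (le_trans (modcD _ _))// modc1 lerD2r//.
- rewrite ler_wpM2r ?rpow_ge0// !ler_wpM2l ?mulr_ge0// ler_expR.
  rewrite (le_trans (ler_normD _ _))// !normrN lerD ?normr_nat//.
  by rewrite (le_trans (abs_Re_le _)).
Qed.

(** The exponent 2 is spent on the logarithm and on the shift by [Re h]. *)
Lemma fdiff_cpow_incr_le k (S : R) : exists C, 0 <= C /\
  forall s h x, modc s <= S -> modc h <= 1 -> 1 <= x ->
    modc (iter k (@fdiff R) (cpow_incr s h) x) <=
      C * modc h * rpow (- Rep s - k%:R + 2) x.
Proof.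
elim: k S => [|k IH] S.
  exists 2; split=> // s h x sS h1 x1.
  have x0 : 0 < x by apply: lt_le_trans x1.
  rewrite subr0 -[iter 0 _ _]/(cpow_incr s h) /cpow_incr cpowD.
  rewrite -[X in _ - X]mulr1 -mulrBr modcM modc_cpow rpowD.
  rewrite [leRHS]mulrCA ler_wpM2l ?rpow_ge0//.
  apply: (le_trans (cexpB1_le_expR _)).
  rewrite modcM modcN modc_real (ger0_norm (ln_ge0 x1)).
  rewrite !mulrA -[leLHS]mulrA ler_wpM2l ?mulr_ge0 ?modc_ge0//.
  rewrite (_ : 2 = 1 + 1)// rpowD rpow1//; apply: ler_pM.
  - exact: ln_ge0.
  - exact: expR_ge0.
  - by apply: ltW; apply: ln_sublinear.
  - rewrite -[leRHS]rpow1// ler_expR ler_wpM2r// ln_ge0//.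
have [C [C0 hC]] := IH (S + 1).
have [C' [C'0 hC']] := fdiff_cpow_le k (S + 2).
exists (2 * ((`|S| * C + C') * expR (`|S| + k.+1%:R + 2))); split.
  by rewrite !mulr_ge0 ?addr_ge0 ?mulr_ge0// expR_ge0.
move=> s h x sS h1 x1.
have sS' : modc s <= `|S| by rewrite (le_trans sS)// ler_norm.
have s1S : modc (s + 1) <= S + 1 by rewrite (le_trans (modcD _ _))// modc1 lerD2r.
have A0 : 0 <= (`|S| * C + C') * modc h.
  by rewrite !mulr_ge0 ?addr_ge0 ?mulr_ge0// modc_ge0.
have := @iter_fdiff_step _ (cpow_incr s h) _ k
  ((`|S| * C + C') * modc h) (- Rep s - k.+1%:R + 2) A0
  (fun y => @has_cderiv_cpow_incr _ s h y).
move=> H; apply: (le_trans (H _ x x1)).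
- move=> y y1; rewrite (iter_fdiff_lin (- s) (- h)).
  rewrite (le_trans (modcD _ _))// !modcM !modcN -mulrA mulrDl; apply: lerD.
    rewrite -mulrA; apply: ler_pM; rewrite ?modc_ge0//.
    have := hC (s + 1) h y s1S h1 y1; rewrite cReD/= mulrA.
    rewrite (_ : - (Rep s + 1) - k%:R = - Rep s - k.+1%:R)//.
    by rewrite -natr1; ring.
  rewrite mulrCA ler_wpM2l ?modc_ge0//.
  apply: (le_trans (hC' _ _ _ y1)).
    rewrite (le_trans (modcD _ _))//.
    by rewrite (_ : S + 2 = S + 1 + 1) ?lerD// -addrA.
  rewrite ler_wpM2l// ler_rpow// !cReImE/= -natr1.
  have : `|Rep h| <= 1 by rewrite (le_trans (abs_Re_le _)).
  by rewrite ler_norml => /andP[]; lra.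
- apply: step_weaken; rewrite ?rpow_ge0 ?sqr_ge0 ?modc_ge0//.
    by rewrite addr_ge0 ?mulr_ge0.
  rewrite ler_expR.
  rewrite (le_trans (ler_normD _ _))// lerD ?normr_nat//.
  rewrite (le_trans (ler_normD _ _))// !normrN lerD ?normr_nat//.
  by rewrite (le_trans (abs_Re_le _)).
Qed.

(** The recursion closes because the derivative of the remainder at s involves
    only remainders and increments at s + 1; the exponent 3 leaves room for the
    square of the logarithm. *)
Lemma fdiff_cpow_rem_le k (S : R) : exists C, 0 <= C /\
  forall s h x, modc s <= S -> modc h <= 1 -> 1 <= x ->
    modc (iter k (@fdiff R) (cpow_rem s h) x) <=
      C * modc h ^+ 2 * rpow (- Rep s - k%:R + 3) x.
Proof.
elim: k S => [|k IH] S.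
  exists 4; split=> // s h x sS h1 x1.
  have x0 : 0 < x by apply: lt_le_trans x1.
  have l0 := ln_ge0 x1.
  have lx : ln x <= x by apply: ltW; apply: ln_sublinear.
  rewrite subr0 -[iter 0 _ _]/(cpow_rem s h) /cpow_rem cpowD.
  rewrite (_ : _ + _ = cpow s x *
    (cexp (- h * (ln x)%:C) - 1 - (- h * (ln x)%:C))); last by ring.
  rewrite modcM modc_cpow rpowD.
  rewrite [leRHS]mulrCA ler_wpM2l ?rpow_ge0//.
  apply: (le_trans (cexpB1B_le_expR _)).
  rewrite modcM modcN modc_real (ger0_norm l0) exprMn.
  rewrite [leLHS](_ : _ = 4 * modc h ^+ 2 *
    (ln x ^+ 2 * expR (modc h * ln x))); last by ring.
  apply: ler_wpM2l; first by rewrite mulr_ge0 ?sqr_ge0.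
  rewrite (_ : 3 = 1 + 1 + 1 :> R); last by ring.
  rewrite !rpowD rpow1//; apply: ler_pM.
  - exact: sqr_ge0.
  - exact: expR_ge0.
  - by rewrite -expr2 lerXn2r// nnegrE// ltW.
  - by rewrite -[leRHS]rpow1// ler_expR ler_wpM2r.
have [C [C0 hC]] := IH (S + 1).
have [C' [C'0 hC']] := fdiff_cpow_incr_le k (S + 1).
exists (2 * ((`|S| * C + C') * expR (`|S| + k.+1%:R + 3))); split.
  by rewrite !mulr_ge0 ?addr_ge0 ?mulr_ge0// expR_ge0.
move=> s h x sS h1 x1.
have sS' : modc s <= `|S| by rewrite (le_trans sS)// ler_norm.
have s1S : modc (s + 1) <= S + 1 by rewrite (le_trans (modcD _ _))// modc1 lerD2r.
have A0 : 0 <= (`|S| * C + C') * modc h ^+ 2.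
  by apply: mulr_ge0; [rewrite addr_ge0// mulr_ge0|exact: sqr_ge0].
have := @iter_fdiff_step _ (cpow_rem s h) _ k
  ((`|S| * C + C') * modc h ^+ 2) (- Rep s - k.+1%:R + 3) A0
  (fun y => @has_cderiv_cpow_rem _ s h y).
move=> H; apply: (le_trans (H _ x x1)).
- move=> y y1; rewrite (iter_fdiff_lin (- s) (- h)).
  rewrite (le_trans (modcD _ _))// !modcM !modcN -mulrA mulrDl; apply: lerD.
    rewrite -mulrA; apply: ler_pM; rewrite ?modc_ge0//.
    have := hC (s + 1) h y s1S h1 y1; rewrite cReD/= mulrA.
    rewrite (_ : - (Rep s + 1) - k%:R = - Rep s - k.+1%:R)//.
    by rewrite -natr1; ring.
  rewrite expr2 -mulrA mulrCA ler_wpM2l ?modc_ge0//.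
  apply: (le_trans (hC' _ _ _ s1S h1 y1)).
  rewrite -mulrA ler_wpM2l// ler_wpM2l ?modc_ge0// ler_rpow//.
  by rewrite !cReImE/= -natr1; lra.
- apply: step_weaken; rewrite ?rpow_ge0 ?sqr_ge0 ?modc_ge0//.
    by rewrite addr_ge0 ?mulr_ge0.
  rewrite ler_expR.
  rewrite (le_trans (ler_normD _ _))// lerD ?normr_nat//.
  rewrite (le_trans (ler_normD _ _))// !normrN lerD ?normr_nat//.
  by rewrite (le_trans (abs_Re_le _)).
Qed.

End differences_of_powers.

(** * Analytic continuation by repeated Abel summation *)

Definition ccvg (R : realType) (z : nat -> R[i]) (l : R[i]) :=
  forall e : R, 0 < e -> exists N, forall n, (N <= n)%N -> modc (z n - l) <= e.

Lemma complex_gt0 (R : realType) (e : R[i]) :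
  0 < e -> 0 < Rep e /\ e = (Rep e)%:C.
Proof. by case: e => a b; rewrite ltcE/= => /andP[/eqP -> ->]. Qed.

Lemma ccvgP (R : realType) (z : nat -> R[i]) (l : R[i]) :
  ccvg z l -> (fun n => z n : R[i]^o) @ \oo --> (l : R[i]^o).
Proof.
move=> h; apply/cvgrPdistC_le => e e0.
have [er ->] := complex_gt0 e0.
have [N hN] := h _ er.
by exists N => // n /= Nn; rewrite -[leLHS]/((modc _)%:C) lecR hN.
Qed.

Lemma ccvgD (R : realType) (z w : nat -> R[i]) (l m : R[i]) :
  ccvg z l -> ccvg w m -> ccvg (fun n => z n + w n) (l + m).
Proof.
move=> zl wm e e0; have e2 : 0 < e / 2 by rewrite divr_gt0.
have [N hN] := zl _ e2; have [M hM] := wm _ e2.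
exists (maxn N M) => n; rewrite geq_max => /andP[Nn Mn].
rewrite [X in modc X](_ : _ = (z n - l) + (w n - m)); last by ring.
by rewrite (le_trans (modcD _ _))// [e]splitr lerD ?hN ?hM.
Qed.

Lemma ccvgN (R : realType) (z : nat -> R[i]) (l : R[i]) :
  ccvg z l -> ccvg (fun n => - z n) (- l).
Proof.
move=> zl e e0; have [N hN] := zl _ e0; exists N => n Nn.
by rewrite -opprD modcN hN.
Qed.

Lemma ccvgZ (R : realType) (a : R[i]) (z : nat -> R[i]) (l : R[i]) :
  ccvg z l -> ccvg (fun n => a * z n) (a * l).
Proof.
move=> zl e e0; have a1 : 0 < modc a + 1 by rewrite ltr_wpDl// modc_ge0.
have [N hN] := zl (e / (modc a + 1)) (divr_gt0 e0 a1); exists N => n Nn.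
rewrite -mulrBr modcM (le_trans (ler_wpM2l (modc_ge0 _) (hN n Nn)))//.
rewrite mulrCA; apply: ler_piMr; first exact: ltW.
by rewrite ler_pdivrMr// mul1r lerDl.
Qed.

Lemma ccvg_cst (R : realType) (l : R[i]) : ccvg (fun=> l) l.
Proof. by move=> e e0; exists 0%N => n _; rewrite subrr modc0 ltW. Qed.

Lemma ccvg_le (R : realType) (z : nat -> R[i]) (l : R[i]) (K : R) N :
  ccvg z l -> (forall n, (N <= n)%N -> modc (z n) <= K) -> modc l <= K.
Proof.
move=> zl zK; apply/ler_addgt0Pr => e e0.
have [M hM] := zl _ e0; have := hM (maxn N M) (leq_maxr _ _).
have := zK (maxn N M) (leq_maxl _ _) => h1 h2.
rewrite -[l](subrK (z (maxn N M))) addrC (le_trans (modcD _ _))// lerD//.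
by rewrite modcBC.
Qed.

Lemma ccvg_unique (R : realType) (z : nat -> R[i]) (l m : R[i]) :
  ccvg z l -> ccvg z m -> l = m.
Proof.
move=> zl zm; apply/eqP; rewrite -subr_eq0; apply/eqP/Normc.eq0_normc.
apply/eqP; rewrite eq_le modc_ge0 andbT.
have := ccvgD zl (ccvgN zm).
move=> /(@ccvg_le _ _ _ 0 0); apply => n _.
by rewrite subrr modc0.
Qed.

Lemma ccvg_components (R : realType) (z : nat -> R[i]) (a b : R) :
  (fun n => Rep (z n)) @ \oo --> a -> (fun n => Imp (z n)) @ \oo --> b ->
  ccvg z (a +i* b).
Proof.
move=> /cvgrPdistC_le ha /cvgrPdistC_le hb e e0.
have e2 : 0 < e / 2 by rewrite divr_gt0.
have [N _ hN] := ha _ e2; have [M _ hM] := hb _ e2.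
exists (maxn N M) => n; rewrite geq_max => /andP[Nn Mn].
rewrite (le_trans (modc_le_ReIm _))// [e]splitr lerD// !cReImE/=.
  exact: hN.
exact: hM.
Qed.

(** Comparable with 1 / n ^ 2, with partial sums in closed form. *)
Definition telescoping_term (R : realType) (n : nat) : R :=
  (n.+1%:R)^-1 - (n.+2%:R)^-1.

Lemma sum_telescoping_term (R : realType) M :
  \sum_(n < M) telescoping_term R n = 1 - (M.+1%:R)^-1.
Proof.
elim: M => [|M IH]; first by rewrite big_ord0 invr1 subrr.
by rewrite big_ord_recr /= IH /telescoping_term addrA subrK.
Qed.

Lemma telescoping_term_ge0 (R : realType) n : 0 <= telescoping_term R n.
Proof. by rewrite subr_ge0 lef_pV2 ?posrE// ler_nat. Qed.

Lemma rpowN2_le_telescoping_term (R : realType) n :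
  rpow (-2) (n.+1%:R : R) <= 2 * telescoping_term R n.
Proof.
rewrite /rpow mulNr expRN mulrDl mul1r expRD lnK ?posrE//.
rewrite /telescoping_term -natr1; set x : R := n.+1%:R.
have x1 : 1 <= x by rewrite ler1n.
have x0 : 0 < x by apply: lt_le_trans x1.
have x10 : 0 < x + 1 by rewrite addr_gt0.
rewrite [leRHS](_ : _ = 2 / (x * (x + 1))); last first.
  by field; rewrite !gt_eqF.
rewrite -[leLHS]mul1r ler_pdivrMr ?mulr_gt0// mulrAC ler_pdivlMr ?mulr_gt0//.
by rewrite mul1r; nra.
Qed.

Lemma cvg_series_telescoping_term (R : realType) : cvgn (series (telescoping_term R)).
Proof.
apply: nondecreasing_is_cvgn.
  apply/nondecreasing_seqP => n; rewrite /series/= big_nat_recr//= lerDl.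
  exact: telescoping_term_ge0.
exists 1 => _ [M _ <-]; rewrite /series/= big_mkord sum_telescoping_term.
by rewrite lerBlDr lerDl invr_ge0.
Qed.

(** Taken componentwise, where the completeness of R applies. *)
Definition csum (R : realType) (f : nat -> R[i]) : R[i] :=
  limn (series (fun n => Rep (f n))) +i* limn (series (fun n => Imp (f n))).

Lemma ccvg_csum (R : realType) (f : nat -> R[i]) (B : R) :
  (forall n, modc (f n) <= B * telescoping_term R n) ->
  ccvg (fun M => \sum_(n < M) f n) (csum f).
Proof.
move=> fB.
have hcvg (u : nat -> R) : (forall n, `|u n| <= modc (f n)) ->
    cvgn (series u).
  move=> uf; apply: normed_cvg.
  apply: (series_le_cvg (v_ := fun n => B * telescoping_term R n)).
  - by move=> n /=.
  - by move=> n /=; apply: le_trans (fB n); apply: modc_ge0.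
  - by move=> n /=; apply: (le_trans (uf n)).
  - exact: (@is_cvg_seriesZ R (telescoping_term R) B (@cvg_series_telescoping_term R)).
have hR : (fun M => Rep (\sum_(n < M) f n)) = series (fun n => Rep (f n)).
  apply/funext => M; rewrite /series/= big_mkord.
  by apply: (big_morph (fun z : R[i] => Rep z)) => //; exact: cReD.
have hI : (fun M => Imp (\sum_(n < M) f n)) = series (fun n => Imp (f n)).
  apply/funext => M; rewrite /series/= big_mkord.
  by apply: (big_morph (fun z : R[i] => Imp z)) => //; exact: cImD.
apply: ccvg_components.
- by rewrite hR; apply: hcvg => n; apply: abs_Re_le.
- by rewrite hI; apply: hcvg => n; apply: abs_Im_le.
Qed.

Lemma sum_modc_le (R : realType) (f : nat -> R[i]) (B : R) M : 0 <= B ->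
  (forall n, modc (f n) <= B * telescoping_term R n) ->
  modc (\sum_(n < M) f n) <= B.
Proof.
move=> B0 fB; apply: (le_trans (modc_sum _ _ _)).
apply: (@le_trans _ _ (\sum_(n < M) B * telescoping_term R n)).
  by apply: ler_sum => n _; apply: fB.
rewrite -mulr_sumr sum_telescoping_term ler_piMr// lerBlDr lerDl invr_ge0//.
Qed.

Lemma rpow_vanish (R : realType) (p e : R) : p < 0 -> 0 < e ->
  exists N, forall n, (N <= n)%N -> rpow p (n.+1%:R : R) <= e.
Proof.
move=> p0 e0; exists (Num.truncn (expR (ln e / p))) => n Nn.
rewrite /rpow -[leRHS]lnK ?posrE// ler_expR mulrC -ler_ndivrMr//.
rewrite -[leLHS]expRK ler_ln ?posrE ?expR_gt0//.
apply/ltW; apply: (lt_le_trans (Num.Theory.truncnS_gt _)).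
by rewrite ler_nat.
Qed.

(** Reduces holomorphy to one estimate that can be summed term by term. *)
Lemma derivable_of_quadratic_remainder (R : realType) (f : R[i] -> R[i])
  (z d : R[i]) (C : R) :
  (forall h, modc h <= 1 -> modc (f (z + h) - f z - h * d) <= C * modc h ^+ 2) ->
  derivable (f : R[i]^o -> R[i]^o) z 1.
Proof.
move=> hf; apply/cvg_ex; exists d; apply/cvgrPdistC_le => e e0.
have [er ei] := complex_gt0 e0.
set r := Rep e in er ei.
have C1 : 0 < `|C| + 1 by rewrite ltr_wpDl.
set del := Num.min 1 (r / (`|C| + 1)).
have del0 : 0 < del by rewrite lt_min ltr01 divr_gt0.
exists del%:C; first by rewrite /= ltcR.
move=> h /=; rewrite sub0r normrN => hdel h0.
have {}hdel : modc h < del by rewrite -ltcR.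
rewrite ei -[leLHS]/((modc _)%:C) lecR.
have h1 : modc h <= 1.
  by apply/ltW/(lt_le_trans hdel); rewrite ge_min lexx.
have hr : modc h <= r / (`|C| + 1).
  by apply/ltW/(lt_le_trans hdel); rewrite ge_min lexx orbT.
rewrite /GRing.scale/= mulr1 [h + z]addrC.
rewrite [X in modc X](_ : _ = h^-1 * (f (z + h) - f z - h * d)); last first.
  by rewrite [RHS]mulrBr mulKf.
have hp : 0 < modc h.
  rewrite lt_neqAle modc_ge0 andbT eq_sym.
  by apply: contra h0 => /eqP/Normc.eq0_normc ->.
rewrite modcM modcV mulrC ler_pdivrMr//.
apply: (le_trans (hf h h1)).
rewrite expr2 mulrA ler_wpM2r ?modc_ge0//.
apply: (@le_trans _ _ ((`|C| + 1) * modc h)).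
  rewrite ler_wpM2r ?modc_ge0// (le_trans (ler_norm _))// lerDl//.
by rewrite mulrC -ler_pdivlMr.
Qed.

Section continuation.
Context (R : realType) (c : nat -> nat -> R[i]).
Hypothesis c_bounded : forall k, exists B, forall n, modc (c k n) <= B.
Hypothesis c_rec : forall k n, c k n.+1 = c k.+1 n - c k.+1 n.+1.
Implicit Types (s z h : R[i]).

Definition diff_term k (f : R -> R[i]) (m : nat) : R[i] :=
  c k m.+1 * iter k (@fdiff R) f (m.+1%:R).

Definition boundary k (f : R -> R[i]) : R[i] :=
  \sum_(j < k) c j.+1 0 * iter j (@fdiff R) f 1.

(** What becomes of the sum of the c 0 n f(n), n >= 1, after k Abel summations:
    the boundary terms at 1 and a series of k-th differences. *)
Definition regsum k (f : R -> R[i]) : R[i] :=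
  boundary k f + csum (diff_term k f).

Lemma abel_summation k f M :
  boundary k f + \sum_(m < M) diff_term k f m =
  boundary k.+1 f + \sum_(m < M) diff_term k.+1 f m -
    c k.+1 M * iter k (@fdiff R) f (M.+1%:R).
Proof.
rewrite /boundary big_ord_recr /=.
elim: M => [|M IH]; first by rewrite !big_ord0 !addr0 addrK.
rewrite !big_ord_recr /= addrA IH /diff_term c_rec iter_fdiffS /fdiff.
by rewrite natr1; ring.
Qed.

Lemma c_bound_pos k : exists B, 0 <= B /\ forall n, modc (c k n) <= B.
Proof.
have [B hB] := c_bounded k; exists `|B|; split => // n.
by rewrite (le_trans (hB n))// ler_norm.
Qed.

(** The boundary terms at infinity disappear because the k-th differences
    already tend to 0 in the half-plane Re s + k > 0, one unit to the left of
    absolute convergence. *)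
Lemma boundary_term_vanish k s : 0 < Rep s + k%:R ->
  ccvg (fun M => c k.+1 M * iter k (@fdiff R) (cpow s) (M.+1%:R)) 0.
Proof.
move=> sk e e0.
have [B [B0 hB]] := c_bound_pos k.+1.
have [C [C0 hC]] := @fdiff_cpow_le R k (modc s).
have D0 : 0 < B * C + 1 by rewrite ltr_wpDl// mulr_ge0.
have p0 : - Rep s - k%:R < 0 by rewrite -opprD oppr_lt0.
have [N hN] := rpow_vanish p0 (divr_gt0 e0 D0).
exists N => n Nn; rewrite subr0 modcM.
apply: (@le_trans _ _ (B * (C * rpow (- Rep s - k%:R) n.+1%:R))).
  by rewrite ler_pM ?modc_ge0 ?hB ?hC// ler1n.
rewrite mulrA; apply: (@le_trans _ _ ((B * C + 1) * (e / (B * C + 1)))).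
  by rewrite ler_pM ?mulr_ge0 ?rpow_ge0 ?hN// lerDl.
by rewrite mulrC divfK// gt_eqF.
Qed.

Definition summable_by k (f : R -> R[i]) (A : R) := forall m : nat,
  modc (iter k (@fdiff R) f (m.+1%:R)) <= A * rpow (-2) (m.+1%:R).

Lemma regsum_cvg k f A : 0 <= A -> summable_by k f A ->
  ccvg (fun M => boundary k f + \sum_(m < M) diff_term k f m) (regsum k f).
Proof.
move=> A0 fA; apply: ccvgD; first exact: ccvg_cst.
have [B [B0 hB]] := c_bound_pos k.
apply: (@ccvg_csum _ _ (B * (A * 2))) => n; rewrite /diff_term modcM -!mulrA.
rewrite ler_pM ?modc_ge0 ?hB// (le_trans (fA n))// ler_wpM2l//.
exact: rpowN2_le_telescoping_term.
Qed.

Lemma cpow_summable k s : 2 <= Rep s + k%:R ->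
  exists A, 0 <= A /\ summable_by k (cpow s) A.
Proof.
move=> sk; have [C [C0 hC]] := @fdiff_cpow_le R k (modc s).
exists C; split=> // m; apply: (le_trans (hC _ _ _ _)); rewrite ?ler1n//.
rewrite ler_wpM2l// ler_rpow ?ler1n//; lra.
Qed.

Lemma partial_sums_cvg_step k s l : 0 < Rep s + k%:R ->
  ccvg (fun M => boundary k.+1 (cpow s) +
                   \sum_(m < M) diff_term k.+1 (cpow s) m) l ->
  ccvg (fun M => boundary k (cpow s) +
                   \sum_(m < M) diff_term k (cpow s) m) l.
Proof.
move=> sk h; under eq_fun do rewrite abel_summation.
have := ccvgD h (ccvgN (boundary_term_vanish sk)).
by rewrite oppr0 addr0.
Qed.

(** With k = 0 this says that the plain partial sums converge to the regularised
    value in the whole half-plane Re s > 0; with j = k' - k it shows that the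
    regularised value does not depend on the number of summations. *)
Lemma partial_sums_cvg k j s : 0 < Rep s + k%:R -> 2 <= Rep s + (k + j)%:R ->
  ccvg (fun M => boundary k (cpow s) + \sum_(m < M) diff_term k (cpow s) m)
    (regsum (k + j) (cpow s)).
Proof.
elim: j k => [|j IH] k sk skj.
  rewrite addn0 in skj *; have [A [A0 hA]] := cpow_summable skj.
  exact: regsum_cvg hA.
apply: partial_sums_cvg_step => //.
rewrite -addSnnS; apply: IH; last by rewrite addSnnS.
by rewrite -natr1 addrA ltr_wpDr.
Qed.

Lemma regsum_indep k k' s : 2 <= Rep s + k%:R -> 2 <= Rep s + k'%:R ->
  regsum k (cpow s) = regsum k' (cpow s).
Proof.
wlog kk : k k' / (k <= k')%N.
  move=> H h1 h2; case/orP: (leq_total k k') => kk; first exact: H.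
  by symmetry; apply: H.
move=> h1 h2; have k0 : 0 < Rep s + k%:R by apply: lt_le_trans h1.
have := @partial_sums_cvg k 0 s k0; rewrite addn0 => /(_ h1) H1.
have := @partial_sums_cvg k (k' - k) s k0; rewrite subnKC// => /(_ h2) H2.
exact: ccvg_unique H1 H2.
Qed.

(** Large enough for k-th differences of n ^ (- s) to be O(n ^ (-2)). *)
Definition abel_depth s : nat := (Num.truncn `|Rep s|).+3.

Lemma abel_depthP s : 2 <= Rep s + (abel_depth s)%:R.
Proof.
rewrite /abel_depth -[_.+3]addn2 natrD.
have h : `|Rep s| <= (Num.truncn `|Rep s|).+1%:R by apply/ltW/Num.Theory.truncnS_gt.
have : - Rep s <= `|Rep s| by rewrite -normrN ler_norm.
lra.
Qed.

Definition continuation s : R[i] := regsum (abel_depth s) (cpow s).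

Lemma continuationE k s : 2 <= Rep s + k%:R ->
  continuation s = regsum k (cpow s).
Proof. by move=> sk; apply: regsum_indep => //; apply: abel_depthP. Qed.

Lemma continuation_cvg s : 0 < Rep s ->
  ccvg (fun M => \sum_(m < M) c 0 m.+1 * cpow s m.+1%:R) (continuation s).
Proof.
move=> s0; have := @partial_sums_cvg 0 (abel_depth s) s.
rewrite addr0 add0n => /(_ s0 (abel_depthP s)).
by rewrite /boundary big_ord0; under eq_fun do rewrite add0r.
Qed.

Lemma boundary_lin k (a b : R[i]) f g :
  boundary k (fun x => a * f x + b * g x) = a * boundary k f + b * boundary k g.
Proof.
rewrite /boundary !mulr_sumr -big_split/=; apply: eq_bigr => j _.
by rewrite iter_fdiff_lin; ring.
Qed.

Lemma diff_term_lin k (a b : R[i]) f g m :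
  diff_term k (fun x => a * f x + b * g x) m =
    a * diff_term k f m + b * diff_term k g m.
Proof. by rewrite /diff_term iter_fdiff_lin; ring. Qed.

Lemma summable_by_lin k (a b : R[i]) f g A B :
  summable_by k f A -> summable_by k g B ->
  summable_by k (fun x => a * f x + b * g x) (modc a * A + modc b * B).
Proof.
move=> fA gB m; rewrite iter_fdiff_lin (le_trans (modcD _ _))// !modcM mulrDl.
by rewrite -!mulrA lerD// ler_wpM2l ?modc_ge0// ?fA ?gB.
Qed.

Lemma regsum_lin k (a b : R[i]) f g A B :
  0 <= A -> 0 <= B -> summable_by k f A -> summable_by k g B ->
  regsum k (fun x => a * f x + b * g x) = a * regsum k f + b * regsum k g.
Proof.
move=> A0 B0 fA gB.
have C0 : 0 <= modc a * A + modc b * B by rewrite addr_ge0 ?mulr_ge0 ?modc_ge0.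
have h1 := regsum_cvg C0 (@summable_by_lin k a b _ _ _ _ fA gB).
have h2 := ccvgD (ccvgZ a (regsum_cvg A0 fA)) (ccvgZ b (regsum_cvg B0 gB)).
apply: ccvg_unique h1 _; move: h2; congr (ccvg _ _); apply/funext => M.
rewrite boundary_lin !mulrDr addrACA; congr (_ + _).
by rewrite !mulr_sumr -big_split; apply: eq_bigr => m _; rewrite diff_term_lin.
Qed.

Definition neg_log_cpow z (x : R) : R[i] := - (ln x)%:C * cpow z x.

Lemma cpow_remE z h : cpow_rem z h =
  (fun x => 1 * (1 * cpow (z + h) x + (-1) * cpow z x) + - h * neg_log_cpow z x).
Proof. by apply/funext => x; rewrite /cpow_rem /neg_log_cpow; ring. Qed.

Lemma cpow_rem_summable k z h : 5 <= Rep z + k%:R -> modc h <= 1 ->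
  exists A, 0 <= A /\ summable_by k (cpow_rem z h) A.
Proof.
move=> zk h1; have [C [C0 hC]] := @fdiff_cpow_rem_le R k (modc z).
have s0 : 0 <= C * modc h ^+ 2 by rewrite mulr_ge0// sqr_ge0.
exists (C * modc h ^+ 2); split => // m.
apply: (le_trans (hC z h _ (lexx _) h1 _)); rewrite ?ler1n//.
rewrite ler_wpM2l// ler_rpow ?ler1n//; lra.
Qed.

(** At h = 1 the remainder expresses the derivative of the power in s
    through functions already known to be summable. *)
Lemma neg_log_summable k z : 5 <= Rep z + k%:R ->
  exists A, 0 <= A /\ summable_by k (neg_log_cpow z) A.
Proof.
move=> zk.
have m1 : modc (1 : R[i]) <= 1 by rewrite modc1.
have [A1 [A10 h1]] := @cpow_rem_summable k z 1 zk m1.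
have [|A2 [A20 h2]] := @cpow_summable k (z + 1); first by rewrite cReD/=; lra.
have [|A3 [A30 h3]] := @cpow_summable k z; first by lra.
have h4 := summable_by_lin 1 (-1) h2 h3.
have h5 := summable_by_lin 1 (-1) h4 h1.
rewrite (_ : neg_log_cpow z = (fun x => 1 * (1 * cpow (z + 1) x +
  (-1) * cpow z x) + (-1) * cpow_rem z 1 x)); last first.
  by apply/funext => x; rewrite /cpow_rem /neg_log_cpow; ring.
eexists; split; last exact: h5.
by rewrite !addr_ge0 ?mulr_ge0 ?addr_ge0 ?mulr_ge0 ?modc_ge0.
Qed.

Lemma regsum_cpow_rem_le k z : 5 <= Rep z + k%:R ->
  exists C, forall h, modc h <= 1 ->
    modc (regsum k (cpow_rem z h)) <= C * modc h ^+ 2.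
Proof.
move=> zk.
have hB (j : nat) : exists C, forall h, modc h <= 1 ->
    modc (c j.+1 0 * iter j (@fdiff R) (cpow_rem z h) 1) <= C * modc h ^+ 2.
  have [C [C0 hC]] := @fdiff_cpow_rem_le R j (modc z).
  exists (modc (c j.+1 0) * C) => h h1; rewrite modcM -mulrA.
  rewrite ler_wpM2l ?modc_ge0// (le_trans (hC z h 1 (lexx _) h1 (lexx _)))//.
  by rewrite /rpow ln1 mulr0 expR0 mulr1.
have {hB} [b hb] := choice hB.
have [C [C0 hC]] := @fdiff_cpow_rem_le R k (modc z).
have [B [B0 hB]] := c_bound_pos k.
exists (\sum_(j < k) b j + B * (C * 2)) => h h1.
have s0 : 0 <= C * modc h ^+ 2 by rewrite mulr_ge0// sqr_ge0.
have hs : summable_by k (cpow_rem z h) (C * modc h ^+ 2).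
  move=> m; apply: (le_trans (hC z h _ (lexx _) h1 _)); rewrite ?ler1n//.
  rewrite ler_wpM2l// ler_rpow ?ler1n//; lra.
apply: (ccvg_le (regsum_cvg s0 hs) (N := 0%N)) => M _.
rewrite (le_trans (modcD _ _))// mulrDl lerD//.
  apply: (le_trans (modc_sum _ _ _)); rewrite mulr_suml.
  by apply: ler_sum => j _; apply: hb.
apply: sum_modc_le.
  by apply: mulr_ge0; [rewrite mulr_ge0// mulr_ge0|exact: sqr_ge0].
move=> n; rewrite /diff_term modcM.
rewrite [leRHS](_ : _ = B * (C * modc h ^+ 2 * (2 * telescoping_term R n))); last by ring.
rewrite ler_pM ?modc_ge0 ?hB// (le_trans (hs n))// ler_wpM2l//.
exact: rpowN2_le_telescoping_term.
Qed.

Lemma continuation_entire : entire continuation.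
Proof.
(* One depth has to serve the whole disc of radius 1 around z, and the
   remainder decays three powers more slowly than the terms. *)
move=> z; set k := (abel_depth z + 3)%N.
have zk : 5 <= Rep z + k%:R.
  by have := abel_depthP z; rewrite /k natrD; lra.
have [C hC] := regsum_cpow_rem_le zk.
apply: (@derivable_of_quadratic_remainder _ _ z (regsum k (neg_log_cpow z)) C).
move=> h h1; rewrite (@continuationE k z); last by lra.
have zhk : 2 <= Rep (z + h) + k%:R.
  rewrite cReD; have := le_trans (abs_Re_le h) h1.
  by rewrite ler_norml => /andP[]; lra.
rewrite (continuationE zhk).
have [A1 [A10 s1]] := cpow_summable zhk.
have [|A2 [A20 s2]] := @cpow_summable k z; first by lra.
have [A3 [A30 s3]] := neg_log_summable zk.
have s12 := summable_by_lin 1 (-1) s1 s2.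
have e1 := regsum_lin 1 (-1) A10 A20 s1 s2.
have A12 : 0 <= modc (1 : R[i]) * A1 + modc (-1 : R[i]) * A2.
  by rewrite addr_ge0 ?mulr_ge0 ?modc_ge0.
have e2 := regsum_lin 1 (- h) A12 A30 s12 s3.
have := hC h h1; rewrite cpow_remE e2 e1.
by rewrite !mul1r mulN1r mulNr.
Qed.

End continuation.

(** * Self-similarity and support of the Cantor measure *)

(** The two similarities generating the Cantor set are the cases a = 0 and
    a = 2 / 3. *)
Definition third_shift (R : realType) (a : R) (x : measurableTypeR R) :
  measurableTypeR R := x / 3 + a.

Lemma measurable_third_shift (R : realType) (a : R) : measurable_fun setT (third_shift a).
Proof.
apply: measurable_funD; last exact: measurable_cst.
exact: mulrr_measurable.
Qed.

HB.instance Definition _ (R : realType) (a : R) :=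
  isMeasurableFun.Build _ _ _ _ (third_shift a) (@measurable_third_shift R a).

Section cantor_measure.
Context (R : realType) (mu : probability (measurableTypeR R) R).
Hypothesis hmu : is_cantor_measure mu.

Lemma cantor_ge0_integral (f : R -> R) :
  measurable_fun [set: measurableTypeR R] f -> (forall x, 0 <= f x) ->
  (\int[mu]_x (f x)%:E = (1 / 2)%:E * \int[mu]_x (f (x / 3))%:E +
    (1 / 2)%:E * \int[mu]_x (f (x / 3 + 2 / 3))%:E)%E.
Proof.
move=> mf f0.
have h2 : (0 : R) <= 1 / 2 by rewrite divr_ge0.
have mEf : measurable_fun [set: measurableTypeR R] (EFin \o f).
  exact/measurable_EFinP.
have f0' (x : measurableTypeR R) : setT x -> (0 <= (f x)%:E)%E.
  by rewrite lee_fin.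
transitivity (\int[measure_add (mscale (NngNum h2) (distribution mu (third_shift 0)))
   (mscale (NngNum h2) (distribution mu (third_shift (2 / 3))))]_x (f x)%:E)%E.
  apply: eq_measure_integral => A mA _.
  rewrite [RHS]/= /msum 2!big_ord_recl big_ord0 adde0 /= /mscale/= hmu//.
  congr (_ * _ + _)%E.
  rewrite /distribution /pushforward; congr (mu _).
  by apply/funext => x /=; rewrite /third_shift addr0.
rewrite ge0_integral_measure_add// !ge0_integral_mscale//.
rewrite !ge0_integral_distribution//.
congr (_ * _ + _)%E.
by apply: eq_integral => x _; rewrite /= /third_shift addr0.
Qed.

Lemma bounded_integrable (D : set (measurableTypeR R)) (f : R -> R) (M : R) :
  measurable D -> measurable_fun D f -> (forall x, D x -> `|f x| <= M) ->
  mu.-integrable D (EFin \o f).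
Proof.
move=> mD mf fM; apply: measurable_bounded_integrable => //.
  by rewrite (le_lt_trans (probability_le1 _ _))// ltry.
exists M; split; first exact: num_real.
by move=> y My x Dx; apply: (le_trans (fM x Dx)); exact: ltW.
Qed.

(** Adding the constant 1 reduces to a nonnegative integrand, for which the
    integral is additive in the measure. *)
Lemma cantor_Rintegral (f : R -> R) :
  measurable_fun [set: measurableTypeR R] f -> (forall x, `|f x| <= 1) ->
  \int[mu]_x f x = 1 / 2 * \int[mu]_x f (x / 3) +
    1 / 2 * \int[mu]_x f (x / 3 + 2 / 3).
Proof.
move=> mf f1.
have mfa (a : R) : measurable_fun [set: measurableTypeR R] (f \o third_shift a).
  by apply: measurableT_comp => //; exact: measurable_third_shift.
have i1 (a : R) : mu.-integrable setT (EFin \o (f \o third_shift a)).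
  apply: (@bounded_integrable _ _ 1) => // x _; exact: f1.
have i0 : mu.-integrable setT (EFin \o f).
  apply: (@bounded_integrable _ _ 1) => // x _; exact: f1.
have ic : mu.-integrable setT (EFin \o (cst 1 : R -> R)).
  apply: (@bounded_integrable _ _ 1) => // x _; by rewrite normr1.
have hfin (g : R -> R) : mu.-integrable setT (EFin \o g) ->
    (\int[mu]_x (g x)%:E)%E \is a fin_num by exact: integrable_fin_num.
have iD (a : R) : mu.-integrable setT (EFin \o (fun x => f (third_shift a x) + 1)).
  exact: (integrableD _ (i1 a) ic).
have iD0 : mu.-integrable setT (EFin \o (fun x => f x + 1)).
  exact: (integrableD _ i0 ic).
have := @cantor_ge0_integral (fun x => f x + 1).
move=> /(_ (measurable_funD mf (measurable_cst _))) H.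
have /H {}H : forall x, 0 <= f x + 1.
  by move=> x; have := f1 x; rewrite ler_norml -lerBlDr sub0r => /andP[].
have h1 : \int[mu]_x (f x + 1) = 1 / 2 * \int[mu]_x (f (x / 3) + 1) +
    1 / 2 * \int[mu]_x (f (x / 3 + 2 / 3) + 1).
  have iD1 := iD 0.
  have eq0 : (fun x => f (third_shift 0 x) + 1) = (fun x => f (x / 3) + 1).
    by apply/funext => x; rewrite /third_shift addr0.
  rewrite eq0 in iD1.
  have F1 := hfin _ iD1; have F2 := hfin _ (iD (2 / 3)).
  by rewrite /Rintegral H fineD ?fin_numM// !fineM.
have i10 := i1 0.
have eq0 : f \o third_shift 0 = (fun x => f (x / 3)).
  by apply/funext => x; rewrite /= /third_shift addr0.
rewrite eq0 in i10.
move: h1; rewrite !(RintegralD _ _ ic)//; last exact: (i1 (2 / 3)).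
have mT : fine (mu setT) = 1 by rewrite probability_setT.
rewrite !Rintegral_cst//; rewrite mT; lra.
Qed.

Definition far (r : R) : set (measurableTypeR R) := [set x : R | r < `|x - 1 / 2|].

Lemma measurable_far r : measurable (far r).
Proof.
apply: open_measurable; rewrite /far.
apply: (@open_comp _ _ (fun x : R => `|x - 1 / 2|) [set y | r < y]).
  move=> x _; apply: cvg_norm; apply: cvgB; [exact: cvg_id|exact: cvg_cst].
exact: open_gt.
Qed.

(** The inverses of the two similarities expand distances to 1/2 by the factor 3
    up to an error 1.  As 1/2 is the fixed point of r |-> 3 r - 1, mass beyond
    any larger radius would have to lie arbitrarily far away. *)
Lemma far_expand r : (mu (far r) <= mu (far (3 * r - 1)))%E.
Proof.
rewrite [leLHS](hmu (measurable_far r)).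
have hsub (a : R) : a = 0 \/ a = 2 / 3 ->
    (mu [set x : R | far r (x / 3 + a)%R] <= mu (far (3 * r - 1)))%E.
  move=> ha; apply: le_measure; rewrite ?inE; last 2 first.
  - exact: measurable_far.
  - move=> x; rewrite /far/= => h.
    have : 3 * r < `|x - 1 / 2| + 1.
      rewrite -(@ltr_pM2l _ 3) in h => //.
      apply: (lt_le_trans h).
      rewrite -[X in X * `|_|](ger0_norm (ler0n R 3)) -normrM.
      case: ha => ->.
      + rewrite (_ : 3 * (x / 3 + 0 - 1 / 2) = (x - 1 / 2) - 1); last by lra.
        by rewrite (le_trans (ler_normB _ _))// normr1.
      + rewrite (_ : 3 * (x / 3 + 2 / 3 - 1 / 2) = (x - 1 / 2) + 1); last by lra.
        by rewrite (le_trans (ler_normD _ _))// normr1.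
    by rewrite ltrBlDr.
  rewrite -[X in measurable X]setTI.
  exact: (@measurable_third_shift R a _ _ (measurable_far r)).
have h0 : (mu [set x : R | far r (x / 3)%R] <= mu (far (3 * r - 1)))%E.
  have := hsub 0 (or_introl erefl); congr (mu _ <= _)%E.
  by apply/funext => x /=; rewrite addr0.
have h1 := hsub (2 / 3) (or_intror erefl).
have -> : mu (far (3 * r - 1)) =
   ((1 / 2)%:E * mu (far (3 * r - 1)) + (1 / 2)%:E * mu (far (3 * r - 1)))%E.
  rewrite -ge0_muleDl ?lee_fin// -EFinD (_ : 1 / 2 + 1 / 2 = 1) ?mul1e//.
  by lra.
have p2 : (0 <= (1 / 2)%:E :> \bar R)%E by rewrite lee_fin; lra.
by apply: leeD; apply: lee_wpmul2l.
Qed.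

Lemma far_iter r k : (mu (far (1 / 2 + r)) <= mu (far (1 / 2 + 3 ^+ k * r)))%E.
Proof.
elim: k => [|k IH]; first by rewrite expr0 (mul1r r).
apply: (le_trans IH); apply: (le_trans (far_expand _)).
by rewrite exprS (_ : 3 * _ - 1 = 1 / 2 + 3 * 3 ^+ k * r)//; lra.
Qed.

Lemma far_null r : 0 < r -> mu (far (1 / 2 + r)) = 0%E.
Proof.
move=> r0.
pose F (n : nat) : set (measurableTypeR R) := far n%:R.
have hle n : (mu (far (1 / 2 + r)) <= mu (F n))%E.
  set k := (Num.truncn (n%:R / r)).+1.
  apply: (le_trans (far_iter r k)).
  apply: le_measure; rewrite ?inE; [exact: measurable_far..|].
  move=> x; rewrite /F /far/=; apply: le_lt_trans.
  rewrite -[leLHS]add0r lerD// -ler_pdivrMr//.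
  apply: (@le_trans _ _ k%:R); first exact/ltW/Num.Theory.truncnS_gt.
  by rewrite -natrX ler_nat ltnW// ltn_expl.
have cap0 : \bigcap_n F n = set0.
  rewrite -subset0 => x hx.
  have := hx (Num.truncn `|x - 1 / 2|).+1 I.
  rewrite /F /far/= ltNge => /negP; apply.
  exact/ltW/Num.Theory.truncnS_gt.
have := @nonincreasing_cvg_mu _ _ _ mu F.
rewrite cap0 measure0 => /(_ _ _ measurable0 _) hc.
have /hc {}hc : (mu (F 0%N) < +oo)%E.
  by rewrite (le_lt_trans (probability_le1 _ (measurable_far _)))// ltry.
have /hc {}hc : forall i, measurable (F i) by move=> i; exact: measurable_far.
have /hc {}hc : nonincreasing_seq F.
  move=> m n mn; apply/subsetPset => x; rewrite /F /far /=.
  by apply: le_lt_trans; rewrite ler_nat.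
apply/eqP; rewrite eq_le measure_ge0 andbT.
rewrite -(cvg_lim _ hc)//; apply: lime_ge.
  by apply/cvg_ex; exists 0%E.
by near=> n; exact: hle.
Unshelve. all: by end_near. Qed.

Lemma cantor_support : mu (~` `[0, 1]%classic) = 0%E.
Proof.
have sub : ~` `[0, 1]%classic `<=` \bigcup_n far (1 / 2 + (n.+1%:R)^-1).
  move=> x /= /negP; rewrite in_itv/= => hx.
  have d0 : 0 < `|x - 1 / 2| - 1 / 2.
    rewrite subr_gt0 ltNge; apply: contra hx; rewrite ler_norml.
    by move=> /andP[h1 h2]; apply/andP; split; lra.
  exists (Num.truncn (`|x - 1 / 2| - 1 / 2)^-1) => //; rewrite /far/=.
  rewrite addrC -ltrBrDr -[ltRHS]invrK ltf_pV2 ?posrE ?invr_gt0//.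
  exact: Num.Theory.truncnS_gt.
have mF n : measurable (far (1 / 2 + (n.+1%:R)^-1)) by exact: measurable_far.
apply/eqP; rewrite eq_le measure_ge0 andbT.
apply: (@le_trans _ _ (mu (\bigcup_n far (1 / 2 + (n.+1%:R)^-1)))).
  apply: le_measure; rewrite ?inE//; last exact: bigcup_measurable.
  by apply: measurableC; exact: measurable_itv.
have /negligibleP : mu.-negligible (\bigcup_n far (1 / 2 + (n.+1%:R)^-1)).
  apply: negligible_bigcup => n; apply/negligibleP => //.
  by apply: far_null; rewrite invr_gt0.
by move=> -> //; exact: bigcup_measurable.
Qed.

End cantor_measure.

(** * The Fourier coefficients and their smoothed versions *)

Section fourier.
Context (R : realType) (mu : probability (measurableTypeR R) R).
Hypothesis hmu : is_cantor_measure mu.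

Definition unit_itv : set (measurableTypeR R) := `[0, 1]%classic.

Lemma measurable_unit_itv : measurable unit_itv.
Proof. exact: measurable_itv. Qed.

Lemma mass_unit_itv : fine (mu unit_itv) = 1.
Proof.
have := probability_setC mu measurable_unit_itv; rewrite (cantor_support hmu).
have : (mu unit_itv) \is a fin_num by rewrite fin_num_measure//; exact: measurable_unit_itv.
by case: (mu unit_itv) => //= r _ /eqP; rewrite -EFinB eqe eq_sym subr_eq0 => /eqP.
Qed.

Lemma Rintegral_unit_itv (f : R -> R) (M : R) :
  measurable_fun [set: measurableTypeR R] f -> (forall x, `|f x| <= M) ->
  \int[mu]_x f x = \int[mu]_(x in unit_itv) f x.
Proof.
move=> mf fM; rewrite /Rintegral; congr fine.
have mU := measurable_unit_itv.
rewrite (negligible_integral (N := ~` unit_itv)) ?setDE ?setCK ?setTI//.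
- exact: measurableC.
- by apply: (@bounded_integrable _ _ _ _ M).
- exact: (cantor_support hmu).
Qed.

Definition bounded_meas (F : R -> R[i]) := [/\
  measurable_fun unit_itv (fun x => Rep (F x)),
  measurable_fun unit_itv (fun x => Imp (F x)) &
  exists M, forall x, unit_itv x -> modc (F x) <= M].

(** Restricted to the unit interval, so that integrands may be singular at angles
    outside the support. *)
Definition cintegral (F : R -> R[i]) : R[i] :=
  (\int[mu]_(x in unit_itv) Rep (F x)) +i* (\int[mu]_(x in unit_itv) Imp (F x)).

Lemma bounded_measD F G : bounded_meas F -> bounded_meas G -> bounded_meas (fun x => F x + G x).
Proof.
move=> [F1 F2 [M FM]] [G1 G2 [N GN]]; split.
- by under eq_fun do rewrite cReD; exact: measurable_funD.
- by under eq_fun do rewrite cImD; exact: measurable_funD.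
- by exists (M + N) => x xU; rewrite (le_trans (modcD _ _))// lerD ?FM ?GN.
Qed.

Lemma bounded_measM F G : bounded_meas F -> bounded_meas G -> bounded_meas (fun x => F x * G x).
Proof.
move=> [F1 F2 [M FM]] [G1 G2 [N GN]]; split.
- under eq_fun do rewrite cReM.
  by apply: measurable_funB; exact: measurable_funM.
- under eq_fun do rewrite cImM.
  by apply: measurable_funD; exact: measurable_funM.
- by exists (M * N) => x xU; rewrite modcM ler_pM ?modc_ge0 ?FM ?GN.
Qed.

Lemma bounded_meas_cst (a : R[i]) : bounded_meas (fun=> a).
Proof. by split; [exact: measurable_cst..|exists (modc a)]. Qed.

Lemma bounded_measX F k : bounded_meas F -> bounded_meas (fun x => F x ^+ k).
Proof.
move=> nF; elim: k => [|k IH].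
  by under eq_fun do rewrite expr0; exact: bounded_meas_cst.
by under eq_fun do rewrite exprS; exact: bounded_measM.
Qed.

Lemma bounded_meas_integrable F : bounded_meas F ->
  mu.-integrable unit_itv (EFin \o (fun x => Rep (F x))) /\
  mu.-integrable unit_itv (EFin \o (fun x => Imp (F x))).
Proof.
move=> [F1 F2 [M FM]]; split; apply: (@bounded_integrable _ _ _ _ M) => //.
- exact: measurable_unit_itv.
- by move=> x xU; rewrite (le_trans (abs_Re_le _))// FM.
- exact: measurable_unit_itv.
- by move=> x xU; rewrite (le_trans (abs_Im_le _))// FM.
Qed.

Lemma cintegralD F G : bounded_meas F -> bounded_meas G ->
  cintegral (fun x => F x + G x) = cintegral F + cintegral G.
Proof.
move=> /bounded_meas_integrable[F1 F2] /bounded_meas_integrable[G1 G2].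
have mU := measurable_unit_itv.
apply: complex_ext; rewrite /cintegral !cReImE/=.
- by under eq_Rintegral do rewrite cReD; rewrite RintegralD.
- by under eq_Rintegral do rewrite cImD; rewrite RintegralD.
Qed.

Lemma cintegralZ (a : R[i]) F : bounded_meas F -> cintegral (fun x => a * F x) = a * cintegral F.
Proof.
move=> nF; have [F1 F2] := bounded_meas_integrable nF.
have mU := measurable_unit_itv.
have h (b : R) (f : R -> R) : mu.-integrable unit_itv (EFin \o f) ->
    mu.-integrable unit_itv (EFin \o (fun x => b * f x)).
  by move=> hf; exact: (integrableZl _ b hf).
apply: complex_ext; rewrite /cintegral !cReImE/=.
- under eq_Rintegral do rewrite cReM.
  by rewrite RintegralB ?h// !RintegralZl.
- under eq_Rintegral do rewrite cImM.
  by rewrite RintegralD ?h// !RintegralZl.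
Qed.

Lemma eq_cintegral F G : (forall x, unit_itv x -> F x = G x) -> cintegral F = cintegral G.
Proof.
move=> FG; apply: complex_ext; rewrite /cintegral /=.
- by apply: eq_Rintegral => x; rewrite inE => xU; rewrite /= FG.
- by apply: eq_Rintegral => x; rewrite inE => xU; rewrite /= FG.
Qed.

Lemma modc_cintegral_le F (B : R) : bounded_meas F ->
  (forall x, unit_itv x -> modc (F x) <= B) -> modc (cintegral F) <= 2 * B.
Proof.
move=> nF FB; have [F1 F2] := bounded_meas_integrable nF.
have mU := measurable_unit_itv.
have h (f : R -> R) : mu.-integrable unit_itv (EFin \o f) ->
    (forall x, unit_itv x -> `|f x| <= B) -> `|\int[mu]_(x in unit_itv) f x| <= B.
  move=> hf fB; apply: (le_trans (le_normr_Rintegral mU hf)).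
  have -> : B = \int[mu]_(x in unit_itv) B.
    by rewrite Rintegral_cst// mass_unit_itv mulr1.
  apply: le_Rintegral => //; first exact: integrable_norm.
  by apply: (@bounded_integrable _ _ _ (cst B) `|B|) => //; exact: measurable_cst.
apply: (le_trans (modc_le_ReIm _)); rewrite mulrDl !mul1r lerD//=.
- by apply: h => // x xU; rewrite (le_trans (abs_Re_le _))// FB.
- by apply: h => // x xU; rewrite (le_trans (abs_Im_le _))// FB.
Qed.

Lemma cintegral_sum (I : Type) (r : seq I) (a : I -> R[i]) (F : I -> R -> R[i]) :
  (forall i, bounded_meas (F i)) ->
  bounded_meas (fun x => \sum_(i <- r) a i * F i x) /\
  cintegral (fun x => \sum_(i <- r) a i * F i x) = \sum_(i <- r) a i * cintegral (F i).
Proof.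
move=> nF; elim: r => [|i r [IH1 IH2]].
  under eq_fun do rewrite big_nil.
  split; first exact: bounded_meas_cst.
  rewrite big_nil; have := cintegralZ 0 (bounded_meas_cst 0).
  by under eq_fun do rewrite mul0r; rewrite mul0r.
under eq_fun do rewrite big_cons.
have nai : bounded_meas (fun x => a i * F i x) by apply: bounded_measM => //; exact: bounded_meas_cst.
split; first exact: bounded_measD.
by rewrite cintegralD// cintegralZ// big_cons IH2.
Qed.

(** Integrals against the rescaled measure are pulled back to the unit interval;
    this is the angle over x. *)
Definition angle (x : R) : R := 1 / 2 + 3 / 2 * x.

Lemma angle_range x : unit_itv x -> 1 / 2 <= angle x <= 2.
Proof. by rewrite /unit_itv/= in_itv/= /angle => /andP[x0 x1]; apply/andP; split; lra. Qed.

(** The character theta |-> e ^ (i a theta), in the variable x. *)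
Definition charac (a : R) (x : R) : R[i] := cexp (0 +i* (a * angle x)).

Lemma characD a b x : charac (a + b) x = charac a x * charac b x.
Proof.
by rewrite /charac -cexpD; congr cexp; apply: complex_ext; rewrite !cReImE/=;
  [rewrite addr0|rewrite mulrDl].
Qed.

Lemma modc_charac a x : modc (charac a x) = 1.
Proof. by rewrite modc_cexp expR0. Qed.

Lemma Re_charac a x : Rep (charac a x) = cos (a * angle x).
Proof. by rewrite /charac /cexp /= expR0 mul1r. Qed.

Lemma Im_charac a x : Imp (charac a x) = sin (a * angle x).
Proof. by rewrite /charac /cexp /= expR0 mul1r. Qed.

Lemma measurable_trig_affine (a b : R) :
  measurable_fun [set: measurableTypeR R] (fun x : R => cos (b + a * x)) /\
  measurable_fun [set: measurableTypeR R] (fun x : R => sin (b + a * x)).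
Proof.
have h : continuous (fun x : R => b + a * x).
  move=> x; apply: cvgD; first exact: cvg_cst.
  by apply: cvgM; [exact: cvg_cst|exact: cvg_id].
split; apply: continuous_measurable_fun => x.
- by apply: continuous_comp; [exact: h|exact: continuous_cos].
- by apply: continuous_comp; [exact: h|exact: continuous_sin].
Qed.

Lemma angle_affine (a x : R) : a * angle x = a * (1 / 2) + a * (3 / 2) * x.
Proof. rewrite /angle; ring. Qed.

Lemma bounded_meas_charac a : bounded_meas (charac a).
Proof.
have [h1 h2] := measurable_trig_affine (a * (3 / 2)) (a * (1 / 2)).
split.
- under eq_fun do rewrite Re_charac angle_affine.
  by apply: measurable_funTS.
- under eq_fun do rewrite Im_charac angle_affine.
  by apply: measurable_funTS.
- by exists 1 => x _; rewrite modc_charac.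
Qed.

Lemma fourier_coefE n :
  fourier_coef (rescaled_measure mu) n = cintegral (charac n%:R).
Proof.
have [h1 h2] := measurable_trig_affine (n%:R * (3 / 2)) (n%:R * (1 / 2)).
have [g1 g2] := measurable_trig_affine n%:R 0.
have ha x : n%:R * (rescale x : R) = n%:R * angle x by [].
rewrite /fourier_coef /cintegral; congr (_ +i* _).
- under [RHS]eq_Rintegral do rewrite Re_charac angle_affine.
  rewrite -(@Rintegral_unit_itv _ 1)//; last first.
    by move=> x; rewrite ler_norml cos_geN1 cos_le1.
  rewrite /Rintegral integral_distribution//.
  + by congr fine; apply: eq_integral => x _; rewrite /= ha angle_affine.
  + apply/measurable_EFinP.
    by move: g1; under eq_fun do rewrite add0r.
  + apply: (@bounded_integrable _ _ _ (fun x => cos (n%:R * rescale x)) 1) => //.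
      by under eq_fun do rewrite ha angle_affine.
    by move=> x _; rewrite ler_norml cos_geN1 cos_le1.
- under [RHS]eq_Rintegral do rewrite Im_charac angle_affine.
  rewrite -(@Rintegral_unit_itv _ 1)//; last first.
    by move=> x; rewrite ler_norml sin_geN1 sin_le1.
  rewrite /Rintegral integral_distribution//.
  + by congr fine; apply: eq_integral => x _; rewrite /= ha angle_affine.
  + apply/measurable_EFinP.
    by move: g2; under eq_fun do rewrite add0r.
  + apply: (@bounded_integrable _ _ _ (fun x => sin (n%:R * rescale x)) 1) => //.
      by under eq_fun do rewrite ha angle_affine.
    by move=> x _; rewrite ler_norml sin_geN1 sin_le1.
Qed.

(** A lower bound for the distance from 1 to the arc of the unit circle that
    carries the measure. *)
Definition gap : R := 1 - cos (1 / 2).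

Lemma gap_gt0 : 0 < gap.
Proof.
have p2 := @pi_ge2 R.
rewrite subr_gt0 -[ltRHS]cos0 ltr_cos ?in_itv/=; try (apply/andP; split); try lra.
Qed.

Lemma gap_le_cos x : unit_itv x -> gap <= 1 - cos (angle x).
Proof.
move=> /angle_range/andP[h1 h2]; have := @pi_ge2 R => p2.
rewrite lerD2l lerN2 leNgt ltr_cos ?in_itv/= -?leNgt//;
  by apply/andP; split; lra.
Qed.

Lemma gap_le a x : a = 1 \/ a = - 1 -> unit_itv x -> gap <= modc (charac a x - 1).
Proof.
move=> ha xU; apply: (le_trans (gap_le_cos xU)).
apply: (le_trans _ (abs_Re_le _)); rewrite cReD cReN Re_charac/=.
have -> : cos (a * angle x) = cos (angle x).
  by case: ha => ->; rewrite ?mul1r// mulN1r cosN.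
by rewrite distrC ler_norm.
Qed.

(** Multiplying the measure by e ^ (- i theta) - 1 takes differences of its
    Fourier coefficients; this is the inverse operation. *)
Definition resolvent (x : R) : R[i] := (charac (-1) x - 1)^-1.

Lemma modc_resolvent_le x : unit_itv x -> modc (resolvent x) <= gap^-1.
Proof.
move=> xU; have h := @gap_le (-1) x (or_intror erefl) xU.
rewrite modcV lef_pV2 ?posrE ?gap_gt0//.
exact: lt_le_trans gap_gt0 h.
Qed.

Lemma bounded_meas_resolvent : bounded_meas resolvent.
Proof.
(* q is the squared modulus of e ^ (- i theta) - 1; writing its inverse as
   a real power makes the measurability of the components visible. *)
pose q x := 2 - 2 * cos (angle x).
have [h1 h2] := measurable_trig_affine (3 / 2) (1 / 2).
have mq : measurable_fun unit_itv (fun x => powR (q x) (-1)).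
  apply: (measurableT_comp (@measurable_powR R (-1))).
  apply: measurable_funTS; apply: measurable_funB; first exact: measurable_cst.
  by apply: measurable_funM; [exact: measurable_cst|exact: h1].
have qE x : unit_itv x -> powR (q x) (-1) = (q x)^-1.
  move=> xU; apply: powR_inv1; have := gap_le_cos xU; have := gap_gt0.
  rewrite /q; lra.
have hq x : (cos (angle x) - 1) ^+ 2 + (- sin (angle x)) ^+ 2 = q x.
  transitivity (cos (angle x) ^+ 2 + sin (angle x) ^+ 2 + 1 - 2 * cos (angle x)).
    by ring.
  by rewrite cos2Dsin2 /q; ring.
have RE x : unit_itv x -> Rep (resolvent x) = (cos (angle x) - 1) * powR (q x) (-1).
  move=> xU; rewrite qE// /resolvent /charac /cexp mulN1r cosN sinN expR0 !mul1r.
  rewrite -[_^-1]/(ComplexField.invc _)/= subr0 hq.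
  by [].
have IE x : unit_itv x -> Imp (resolvent x) = sin (angle x) * powR (q x) (-1).
  move=> xU; rewrite qE// /resolvent /charac /cexp mulN1r cosN sinN expR0 !mul1r.
  rewrite -[_^-1]/(ComplexField.invc _)/= subr0 hq.
  by rewrite -mulNr opprK.
split.
- apply: (eq_measurable_fun (fun x => (cos (angle x) - 1) * powR (q x) (-1))).
    by move=> x; rewrite inE => xU; rewrite RE.
  apply: measurable_funM => //; apply: measurable_funB => //.
  by apply: measurable_funTS.
- apply: (eq_measurable_fun (fun x => sin (angle x) * powR (q x) (-1))).
    by move=> x; rewrite inE => xU; rewrite IE.
  by apply: measurable_funM => //; apply: measurable_funTS.
- by exists gap^-1 => x; exact: modc_resolvent_le.
Qed.

Definition smoothed_coef (k n : nat) : R[i] :=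
  cintegral (fun x => charac n%:R x * resolvent x ^+ k).

Lemma smoothed_coef0 n :
  smoothed_coef 0 n = fourier_coef (rescaled_measure mu) n.
Proof.
by rewrite fourier_coefE; apply: eq_cintegral => x _; rewrite expr0 mulr1.
Qed.

Lemma bounded_meas_smoothed k n : bounded_meas (fun x => charac n%:R x * resolvent x ^+ k).
Proof.
by apply: bounded_measM; [exact: bounded_meas_charac|apply: bounded_measX; exact: bounded_meas_resolvent].
Qed.

Lemma smoothed_coef_bounded k : exists B, forall n, modc (smoothed_coef k n) <= B.
Proof.
exists (2 * gap^-1 ^+ k) => n; apply: modc_cintegral_le; first exact: bounded_meas_smoothed.
move=> x xU; rewrite modcM modc_charac mul1r modcX.
by apply: lerXn2r; rewrite ?nnegrE ?modc_ge0 ?invr_ge0 ?(ltW gap_gt0)//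
  modc_resolvent_le.
Qed.

Lemma smoothed_coef_rec k n :
  smoothed_coef k n.+1 = smoothed_coef k.+1 n - smoothed_coef k.+1 n.+1.
Proof.
have nn m := bounded_meas_smoothed k.+1 m.
rewrite -[X in _ = _ + X]mulN1r -cintegralZ// -cintegralD//; last first.
  by apply: bounded_measM => //; exact: bounded_meas_cst.
apply: eq_cintegral => x xU; rewrite mulN1r -mulrBl exprS.
have cc : charac 1 x * charac (-1) x = 1.
  by rewrite -characD subrr /charac mul0r -[_ +i* _]/(0 : R[i]) cexp0.
have nz : charac (-1) x - 1 != 0.
  apply/eqP => z0; have := @gap_le (-1) x (or_intror erefl) xU.
  by rewrite z0 modc0 leNgt gap_gt0.
have hw : charac 1 x = resolvent x * (1 - charac 1 x).
  have -> : 1 - charac 1 x = charac 1 x * (charac (-1) x - 1).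
    by rewrite mulrBr cc mulr1.
  by rewrite mulrCA mulVf// mulr1.
rewrite -natr1 characD {1}hw; ring.
Qed.

End fourier.

(** * The infinite product behind the Fourier transform *)

Section product_bound.
Context (R : realType) (mu : probability (measurableTypeR R) R).
Hypothesis hmu : is_cantor_measure mu.

Definition muhat (xi : R) : R[i] := cintegral mu (fun x => cexp (0 +i* (xi * x))).

Lemma bounded_meas_wave xi : bounded_meas (fun x : R => cexp (0 +i* (xi * x))).
Proof.
have [h1 h2] := measurable_trig_affine xi (0 : R).
split.
- under eq_fun do rewrite /cexp/= expR0 mul1r -[xi * _]add0r.
  by apply: measurable_funTS.
- under eq_fun do rewrite /cexp/= expR0 mul1r -[xi * _]add0r.
  by apply: measurable_funTS.
- by exists 1 => x _; rewrite modc_cexp expR0.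
Qed.

Lemma muhatE xi :
  muhat xi = (\int[mu]_x cos (xi * x)) +i* (\int[mu]_x sin (xi * x)).
Proof.
have [h1 h2] := measurable_trig_affine xi (0 : R).
rewrite /muhat /cintegral; congr (_ +i* _).
- rewrite (Rintegral_unit_itv hmu (M := 1)).
  + by apply: eq_Rintegral => x _; rewrite /cexp/= expR0 mul1r.
  + by under eq_fun do rewrite -[xi * _]add0r.
  + by move=> x; rewrite ler_norml cos_geN1 cos_le1.
- rewrite (Rintegral_unit_itv hmu (M := 1)).
  + by apply: eq_Rintegral => x _; rewrite /cexp/= expR0 mul1r.
  + by under eq_fun do rewrite -[xi * _]add0r.
  + by move=> x; rewrite ler_norml sin_geN1 sin_le1.
Qed.

Lemma wave_integrable (xi : R) :
  mu.-integrable setT (EFin \o (fun x : R => cos (xi * x))) /\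
  mu.-integrable setT (EFin \o (fun x : R => sin (xi * x))).
Proof.
have [h1 h2] := measurable_trig_affine xi (0 : R).
split; apply: (@bounded_integrable _ _ _ _ 1) => //.
- by under eq_fun do rewrite -[xi * _]add0r.
- by move=> x _; rewrite ler_norml cos_geN1 cos_le1.
- by under eq_fun do rewrite -[xi * _]add0r.
- by move=> x _; rewrite ler_norml sin_geN1 sin_le1.
Qed.

(** The two halves of the measure differ by a translation by 2/3, and
    (1 + e ^ (2 i y)) / 2 = cos y * e ^ (i y). *)
Lemma muhat_self_similar xi :
  muhat xi = (cos (xi / 3))%:C * cexp (0 +i* (xi / 3)) * muhat (xi / 3).
Proof.
have [h1 h2] := measurable_trig_affine xi (0 : R).
have [i1 i2] := wave_integrable (xi / 3).
have iZ (b : R) (f : R -> R) : mu.-integrable setT (EFin \o f) ->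
    mu.-integrable setT (EFin \o (fun x => b * f x)).
  by move=> hf; exact: (integrableZl _ b hf).
set e := xi / 3 in i1 i2 *.
have ang1 x : xi * (x / 3) = e * x by rewrite /e; ring.
have ang2 x : xi * (x / 3 + 2 / 3) = e * x + (e + e) by rewrite /e; ring.
rewrite !muhatE.
rewrite (cantor_Rintegral hmu (f := fun x => cos (xi * x))); last 2 first.
- by under eq_fun do rewrite -[xi * _]add0r.
- by move=> x; rewrite ler_norml cos_geN1 cos_le1.
rewrite (cantor_Rintegral hmu (f := fun x => sin (xi * x))); last 2 first.
- by under eq_fun do rewrite -[xi * _]add0r.
- by move=> x; rewrite ler_norml sin_geN1 sin_le1.
have -> : \int[mu]_x cos (xi * (x / 3)) = \int[mu]_x cos (e * x).
  by apply: eq_Rintegral => x _; rewrite ang1.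
have -> : \int[mu]_x sin (xi * (x / 3)) = \int[mu]_x sin (e * x).
  by apply: eq_Rintegral => x _; rewrite ang1.
have -> : \int[mu]_x cos (xi * (x / 3 + 2 / 3)) =
    cos (e + e) * \int[mu]_x cos (e * x) - sin (e + e) * \int[mu]_x sin (e * x).
  rewrite -!RintegralZl// -RintegralB//; try exact: iZ.
  by apply: eq_Rintegral => x _; rewrite ang2 cosD; ring.
have -> : \int[mu]_x sin (xi * (x / 3 + 2 / 3)) =
    cos (e + e) * \int[mu]_x sin (e * x) + sin (e + e) * \int[mu]_x cos (e * x).
  rewrite -!RintegralZl// -RintegralD//; try exact: iZ.
  by apply: eq_Rintegral => x _; rewrite ang2 sinD; ring.
set A := \int[mu]_x cos (e * x); set B := \int[mu]_x sin (e * x).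
have s2 : sin e ^+ 2 = 1 - cos e ^+ 2 by rewrite sin2cos2.
rewrite cosD sinD -!expr2 s2; apply: complex_ext.
- by rewrite !cReImE /cexp/= expR0; field.
- by rewrite !cReImE /cexp/= expR0; field.
Qed.

Lemma modc_muhat_le K xi :
  modc (muhat xi) <= 2 * \prod_(j < K) `|cos (xi / 3 ^+ j.+1)|.
Proof.
elim: K xi => [|K IH] xi.
  rewrite big_ord0; apply: modc_cintegral_le => //; first exact: bounded_meas_wave.
  by move=> x _; rewrite modc_cexp expR0.
rewrite muhat_self_similar !modcM modc_real modc_cexp expR0 mulr1.
rewrite big_ord_recl mulrCA expr1 ler_wpM2l//.
apply: (le_trans (IH _)); rewrite ler_wpM2l//.
rewrite le_eqVlt; apply/orP; left; apply/eqP; apply: eq_bigr => j _.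
by rewrite lift0 [in RHS]exprS invfM mulrA.
Qed.

Lemma modc_fourier_coef_le K n :
  modc (fourier_coef (rescaled_measure mu) n) <=
    2 * \prod_(j < K) `|cos (n%:R / (2 * 3 ^+ j.+1))|.
Proof.
rewrite (fourier_coefE hmu).
rewrite (@eq_cintegral _ mu _ (fun x => charac n%:R 0 *
    cexp (0 +i* (n%:R * (3 / 2) * x)))); last first.
  move=> x _; rewrite /charac -cexpD; congr cexp; apply: complex_ext.
    by rewrite cReImE/= addr0.
  by rewrite cReImE/= /angle; ring.
rewrite cintegralZ; last exact: bounded_meas_wave.
rewrite modcM modc_charac mul1r -[cintegral _ _]/(muhat _) muhat_self_similar.
rewrite !modcM modc_real modc_cexp expR0 mulr1.
rewrite (_ : n%:R * (3 / 2) / 3 = n%:R / 2); last by field.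
rewrite -[leRHS]mul1r; apply: ler_pM; rewrite ?modc_ge0//.
  by rewrite ler_norml cos_geN1 cos_le1.
apply: (le_trans (modc_muhat_le K _)); rewrite ler_wpM2l//.
rewrite le_eqVlt; apply/orP; left; apply/eqP; apply: eq_bigr => j _.
by rewrite invfM mulrA.
Qed.

End product_bound.

(** * Triadic sums of products of cosines *)

Section trigonometric_sums.
Context (R : realType).
Implicit Types (w x : R).
Local Notation pi := (@pi R).

Lemma cos_pi3 : cos (pi / 3) = 1 / 2.
Proof.
set x := pi / 3; set c := cos x.
have p2 := @pi_ge2 R.
have c0 : 0 < c by apply: cos_gt0_pihalf; apply/andP; split; rewrite /x; lra.
have h3 : cos (x + x + x) = - 1.
  by rewrite -cospi; congr cos; rewrite /x; field.
have s2 : sin x ^+ 2 = 1 - c ^+ 2 by rewrite sin2cos2.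
have : (c + 1) * (2 * c - 1) ^+ 2 = 0.
  transitivity (4 * c ^+ 3 - 3 * c + 1); first by ring.
  have : cos (x + x + x) = c ^+ 3 - 3 * c * sin x ^+ 2.
    by rewrite !cosD sinD -/c; ring.
  by rewrite s2 h3 => h; rewrite -[X in _ + X]opprK h; ring.
move=> /eqP; rewrite mulf_eq0 => /orP[/eqP h|]; first by lra.
by rewrite sqrf_eq0 => /eqP h; lra.
Qed.

Lemma three_cos w :
  let p := cos w in let q := cos (w + pi / 3) in let r := cos (w + 2 * (pi / 3)) in
  [/\ r = q - p, p ^+ 2 + q ^+ 2 - p * q = 3 / 4 & cos (3 * w) = - 4 * p * q * r].
Proof.
have c3 := cos_pi3; set x := pi / 3 in c3 *; move=> p q r.
have t2 : sin x ^+ 2 = 3 / 4 by rewrite sin2cos2 c3; field.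
have sw : sin w ^+ 2 = 1 - p ^+ 2 by rewrite sin2cos2.
have qE : q = p / 2 - sin w * sin x by rewrite /q cosD c3 -/p; ring.
have rE : r = - (p / 2) - sin w * sin x.
  rewrite /r (_ : w + 2 * x = w + x + x); last by ring.
  rewrite cosD sinD -/q qE c3 -/p.
  transitivity (p / 4 - sin w * sin x - p * sin x ^+ 2); first by field.
  by rewrite t2; field.
have ts : (sin w * sin x) ^+ 2 = (1 - p ^+ 2) * (3 / 4) by rewrite exprMn sw t2.
split.
- by rewrite qE rE; field.
- transitivity (p ^+ 2 * (3 / 4) + (sin w * sin x) ^+ 2).
    by rewrite qE; field.
  by rewrite ts; field.
- rewrite -mulrA (_ : q * r = (sin w * sin x) ^+ 2 - p ^+ 2 / 4); last first.
    by rewrite qE rE; field.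
  rewrite ts (_ : 3 * w = w + w + w); last by ring.
  transitivity (p ^+ 3 - 3 * p * sin w ^+ 2).
    by rewrite !cosD sinD -/p; ring.
  by rewrite sw; field.
Qed.

Lemma triangle_core (x y : R) : 0 <= x -> 0 <= y ->
  x ^+ 2 + x * y + y ^+ 2 = 3 / 4 ->
  2 * (x + y) <= 16 / 9 + 8 / 9 * (x * y * (x + y)).
Proof.
move=> x0 y0 h; set m := x + y.
have m0 : 0 <= m by rewrite addr_ge0.
have xy : x * y = m ^+ 2 - 3 / 4 by rewrite -h /m; ring.
rewrite xy.
have : 0 <= (m - 1) ^+ 2 * (m + 2) by rewrite mulr_ge0 ?sqr_ge0 ?addr_ge0.
rewrite (_ : (m - 1) ^+ 2 * (m + 2) = m ^+ 3 - 3 * m + 2); last by ring.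
rewrite (_ : (m ^+ 2 - 3 / 4) * m = m ^+ 3 - 3 / 4 * m); last by ring.
lra.
Qed.

(** Among three cosines at angles pi/3 apart the largest absolute value m is the
    sum of the other two, so that the sum is 2 m while |cos (3 w)| is
    4 m^3 - 3 m.  The sum is thus a concave function of |cos (3 w)|, and the
    right-hand side is its tangent at the maximum m = 1: the inequality is
    (m - 1)^2 (m + 2) >= 0. *)
Lemma sum_three_cos_le w :
  `|cos w| + `|cos (w + pi / 3)| + `|cos (w + 2 * (pi / 3))| <=
    16 / 9 + 2 / 9 * `|cos (3 * w)|.
Proof.
have [] := three_cos w; set p := cos w; set q := cos (w + pi / 3).
set r := cos (w + 2 * (pi / 3)).
move=> rE h ->.
rewrite !normrM normrN (ger0_norm (ler0n _ 4)) rE.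
have hh x y S P : 0 <= x -> 0 <= y -> x ^+ 2 + x * y + y ^+ 2 = p ^+ 2 + q ^+ 2 - p * q ->
    S = 2 * (x + y) -> P = 4 * (x * y * (x + y)) -> S <= 16 / 9 + 2 / 9 * P.
  move=> x0 y0 xy -> ->; rewrite h in xy.
  have := triangle_core x0 y0 xy; set T := x * y * (x + y); lra.
have [p0|p0] := leP 0 p; have [q0|q0] := leP 0 q; have [pq|pq] := leP 0 (q - p).
- apply: (hh p (q - p)) => //; rewrite ?(ger0_norm p0) ?(ger0_norm q0)
    ?(ger0_norm pq); ring.
- apply: (hh q (p - q)); rewrite ?(ger0_norm p0) ?(ger0_norm q0)
    ?(ltr0_norm pq) //; [lra|ring..].
- lra.
- apply: (hh p (- q)); rewrite ?(ger0_norm p0) ?(ltr0_norm q0)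
    ?(ltr0_norm pq) //; [lra|ring..].
- apply: (hh (- p) q); rewrite ?(ltr0_norm p0) ?(ger0_norm q0)
    ?(ger0_norm pq) //; [lra|ring..].
- lra.
- apply: (hh (- q) (q - p)); rewrite ?(ltr0_norm p0) ?(ltr0_norm q0)
    ?(ger0_norm pq) //; [lra|ring..].
- apply: (hh (- p) (p - q)); rewrite ?(ltr0_norm p0) ?(ltr0_norm q0)
    ?(ltr0_norm pq) //; [lra|lra|ring..].
Qed.

Lemma sum_three_cos2 w :
  cos w ^+ 2 + cos (w + pi / 3) ^+ 2 + cos (w + 2 * (pi / 3)) ^+ 2 = 3 / 2.
Proof.
have [-> h _] := three_cos w.
transitivity (2 * (cos w ^+ 2 + cos (w + pi / 3) ^+ 2 - cos w * cos (w + pi / 3))).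
  by ring.
by rewrite h; field.
Qed.

Lemma abs_cosDpin x n : `|cos (x + n%:R * pi)| = `|cos x|.
Proof.
elim: n => [|n IH]; first by rewrite mul0r addr0.
by rewrite -natr1 mulrDl mul1r addrA cosDpi normrN.
Qed.

(** Applying the tangent bound at the finer scale produces |cos| and cos^2 at the
    coarser one, and these sums are at most 2 and equal to 3/2:
    16/9 * 2 + 2/9 * 3/2 = 35/9.  The bound 2 at both scales would give 4, which
    exceeds 3 ^ (5/4). *)
Lemma sum_nine_cos_le (phi : R) :
  \sum_(b2 < 3) \sum_(b1 < 3)
    `|cos (3 * phi + (3 * b2 + b1)%:R * (pi / 3))| *
    `|cos (phi + (3 * b2 + b1)%:R * (pi / 9))| <= 35 / 9.
Proof.
rewrite exchange_big /=.
pose w (b : nat) := phi + b%:R * (pi / 9).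
have hb (b : nat) : \sum_(i < 3) `|cos (3 * phi + (3 * i + b)%:R * (pi / 3))| *
    `|cos (phi + (3 * i + b)%:R * (pi / 9))| <=
    `|cos (3 * phi + b%:R * (pi / 3))| *
      (16 / 9 + 2 / 9 * `|cos (3 * phi + b%:R * (pi / 3))|).
  have h3 : 3 * w b = 3 * phi + b%:R * (pi / 3) by rewrite /w; field.
  rewrite (eq_bigr (fun i : 'I_3 => `|cos (3 * w b)| *
      `|cos (w b + i%:R * (pi / 3))|)); last first.
    move=> i _; congr (_ * `|cos _|).
      rewrite -[RHS](abs_cosDpin _ i) h3; congr (`|cos _|).
      by rewrite natrD natrM; field.
    by rewrite /w natrD natrM; field.
  rewrite -mulr_sumr h3 ler_wpM2l// -h3; apply: le_trans (sum_three_cos_le (w b)).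
  by rewrite !big_ord_recr big_ord0 /= mul0r addr0 mul1r add0r.
apply: (@le_trans _ _ (\sum_(i < 3) `|cos (3 * phi + i%:R * (pi / 3))| *
      (16 / 9 + 2 / 9 * `|cos (3 * phi + i%:R * (pi / 3))|))).
  by apply: ler_sum => i _; exact: hb.
rewrite !big_ord_recr big_ord0 /= mul0r addr0 mul1r add0r.
have h1 := sum_three_cos_le (3 * phi); have h2 := sum_three_cos2 (3 * phi).
have hc : `|cos (3 * (3 * phi))| <= 1 by rewrite ler_norml cos_geN1 cos_le1.
move: h2; rewrite -[cos (3 * phi) ^+ 2]real_normK ?num_real//.
rewrite -[cos (3 * phi + pi / 3) ^+ 2]real_normK ?num_real//.
rewrite -[cos (3 * phi + 2 * (pi / 3)) ^+ 2]real_normK ?num_real//.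
move: h1; set a := `|cos (3 * phi)|; set b := `|cos (3 * phi + pi / 3)|.
set c := `|cos (3 * phi + 2 * (pi / 3))| => h1 h2.
rewrite [leLHS](_ : _ = 16 / 9 * (a + b + c) +
  2 / 9 * (a ^+ 2 + b ^+ 2 + c ^+ 2)); last by ring.
by rewrite h2; lra.
Qed.

Lemma abs_cos_near (a b : R) : `|cos a| <= `|cos b| + `|a - b|.
Proof.
have h x y : x <= y -> `|cos y - cos x| <= y - x.
  move=> xy; have := @real_increment_le _ cos (fun z => - sin z) x y 1 xy.
  rewrite mul1r; apply => z _.
  by rewrite normrN ler_norml sin_geN1 sin_le1.
have hab : `|cos a - cos b| <= `|a - b|.
  case: (leP a b) => ab.
    by rewrite distrC [leRHS]ler0_norm ?subr_le0// opprB h.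
  by rewrite [leRHS]gtr0_norm ?subr_gt0// h// ltW.
rewrite -{1}[cos a](subrK (cos b)) addrC (le_trans (ler_normD _ _))// lerD2l//.
Qed.

(** At the lattice point 2 pi i, the factor of scale j of the Fourier transform,
    enlarged by its maximal variation until the next lattice point.  The
    enlargement is summable over j and does not affect the growth rate. *)
Definition cantor_factor (j i : nat) : R :=
  `|cos (pi * i%:R / 3 ^+ j)| + pi / 3 ^+ j.

Definition grid_weight (K i : nat) : R := \prod_(j < K) cantor_factor j.+1 i.

Definition grid_sum (K : nat) : R := \sum_(i < (3 ^ K)%N) grid_weight K i.

Lemma cantor_factor_ge0 j i : 0 <= cantor_factor j i.
Proof. by rewrite addr_ge0// divr_ge0 ?pi_ge0// exprn_ge0. Qed.

Lemma grid_weight_ge0 K i : 0 <= grid_weight K i.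
Proof. by apply: prodr_ge0 => j _; exact: cantor_factor_ge0. Qed.

Lemma cantor_factor_periodic K j a b : (j <= K)%N ->
  cantor_factor j (3 ^ K * b + a) = cantor_factor j a.
Proof.
move=> jK; congr (_ + _); rewrite -(abs_cosDpin (pi * a%:R / _) (3 ^ (K - j) * b)).
congr (`|cos _|); have e : (3 : R) ^+ K = 3 ^+ (K - j) * 3 ^+ j.
  by rewrite -exprD subnK.
rewrite natrD !natrM !natrX e; field.
by rewrite expf_neq0.
Qed.

Lemma sum_by_blocks (F : nat -> R) m B :
  \sum_(i < (m * B)%N) F i = \sum_(b < B) \sum_(a < m) F (m * b + a)%N.
Proof.
elim: B => [|B IH]; first by rewrite muln0 !big_ord0.
by rewrite big_ord_recr /= -IH mulnS addnC big_split_ord.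
Qed.

(** All factors of scale at most K have period 3 ^ K, so the nine lifts of a
    residue mod 3 ^ K to a residue mod 3 ^ (K + 2) only differ in the two new
    factors. *)
Lemma grid_sum_step K :
  grid_sum K.+2 <= (35 / 9 + 27 / 3 ^+ K) * grid_sum K.
Proof.
rewrite /grid_sum (_ : 3 ^ K.+2 = 3 ^ K * (3 * 3))%N; last first.
  by rewrite -(addn2 K) expnD.
rewrite sum_by_blocks exchange_big/= mulr_sumr; apply: ler_sum => a _.
have pK : 0 < (3 : R) ^+ K by rewrite exprn_gt0.
have p2 := @pi_ge2 R; have p4 : pi < 4 by have := @pihalf_lt2 R; lra.
rewrite (eq_bigr (fun b : 'I_(3 * 3) => grid_weight K a *
   (cantor_factor K.+1 (3 ^ K * b + a) * cantor_factor K.+2 (3 ^ K * b + a))));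
  last first.
  move=> b _; rewrite /grid_weight !big_ord_recr /= -mulrA; congr (_ * _).
  by apply: eq_bigr => j _; rewrite cantor_factor_periodic.
rewrite -mulr_sumr mulrC ler_wpM2r ?grid_weight_ge0//.
set phi := pi * a%:R / 3 ^+ K.+2.
set e1 := pi / 3 ^+ K.+1; set e2 := pi / 3 ^+ K.+2.
have E3 : (3 : R) ^+ K != 0 by rewrite gt_eqF.
have e10 : 0 <= e1 by rewrite divr_ge0 ?pi_ge0// exprn_ge0.
have e20 : 0 <= e2 by rewrite divr_ge0 ?pi_ge0// exprn_ge0.
have hb (b : nat) : cantor_factor K.+1 (3 ^ K * b + a) *
    cantor_factor K.+2 (3 ^ K * b + a) <=
    `|cos (3 * phi + b%:R * (pi / 3))| * `|cos (phi + b%:R * (pi / 9))| +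
    (e1 + e2 + e1 * e2).
  rewrite /cantor_factor -/e1 -/e2.
  rewrite (_ : pi * _ / 3 ^+ K.+1 = 3 * phi + b%:R * (pi / 3)); last first.
    by rewrite /phi natrD natrM natrX !exprS; field.
  rewrite (_ : pi * _ / 3 ^+ K.+2 = phi + b%:R * (pi / 9)); last first.
    by rewrite /phi natrD natrM natrX !exprS; field.
  set x := `|_|; set y := `|_|.
  have x1 : x <= 1 by rewrite /x ler_norml cos_geN1 cos_le1.
  have y1 : y <= 1 by rewrite /y ler_norml cos_geN1 cos_le1.
  have h1 : x * e2 <= e2 by rewrite ler_piMl.
  have h2 : e1 * y <= e1 by rewrite ler_piMr.
  rewrite (_ : (x + e1) * (y + e2) = x * y + x * e2 + e1 * y + e1 * e2); last by ring.
  lra.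
apply: (@le_trans _ _ (\sum_(b < (3 * 3)%N)
   (`|cos (3 * phi + b%:R * (pi / 3))| * `|cos (phi + b%:R * (pi / 9))| +
    (e1 + e2 + e1 * e2)))); first by apply: ler_sum => b _; exact: hb.
rewrite big_split /= sumr_const card_ord lerD//.
  rewrite (sum_by_blocks (fun b => `|cos (3 * phi + b%:R * (pi / 3))| *
    `|cos (phi + b%:R * (pi / 9))|)).
  exact: sum_nine_cos_le.
set u := (3 ^+ K)^-1; have u0 : 0 < u by rewrite invr_gt0.
have u1 : u <= 1 by rewrite invf_le1// exprn_ege1// ler1n.
have E1 : e1 = pi / 3 * u by rewrite /e1 /u exprS; field.
have E2 : e2 = pi / 9 * u by rewrite /e2 /u !exprS; field.
have h1 : e1 <= 4 / 3 * u by rewrite E1 ler_wpM2r ?(ltW u0)//; lra.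
have h2 : e2 <= 4 / 9 * u by rewrite E2 ler_wpM2r ?(ltW u0)//; lra.
have h3 : e1 * e2 <= 16 / 27 * u.
  apply: (@le_trans _ _ ((4 / 3 * u) * (4 / 9 * u))); first exact: ler_pM.
  rewrite (_ : _ * _ = 16 / 27 * u * u); last by field.
  by rewrite ler_piMr// mulr_ge0// ltW.
rewrite -mulr_natl (_ : 3 * 3 = 9)%N//.
lra.
Qed.

(** All growth rates are integral powers of 3 ^ (1/8). *)
Definition eighth_root3 : R := expR (ln 3 / 8).

Lemma eighth_root3X n : eighth_root3 ^+ n = expR (n%:R * (ln 3 / 8)).
Proof. by rewrite /eighth_root3 expRM_natl. Qed.

Lemma eighth_root3X8 : eighth_root3 ^+ 8 = 3.
Proof. by rewrite eighth_root3X mulrCA divff ?mulr1 ?lnK// posrE. Qed.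

Lemma eighth_root3_gt1 : 1 < eighth_root3.
Proof. by rewrite /eighth_root3 expR_gt1 divr_gt0// ln_gt0// ltr1n. Qed.

Lemma eighth_root3_ge0 : 0 <= eighth_root3.
Proof. by apply/ltW/(lt_trans ltr01 eighth_root3_gt1). Qed.

Lemma eighth_root3X_ge1 n : 1 <= eighth_root3 ^+ n.
Proof. by rewrite exprn_ege1// ltW// eighth_root3_gt1. Qed.

(** A rational number between 35/9 + 27 / 3 ^ 6 and 3 ^ (5/4). *)
Lemma eighth_root3X10 : 394 / 100 <= eighth_root3 ^+ 10.
Proof.
have a0 : (394 / 100 : R) \is Num.nneg by rewrite nnegrE; lra.
have b0 : eighth_root3 ^+ 10 \is Num.nneg by rewrite nnegrE exprn_ge0// eighth_root3_ge0.
rewrite -(@ler_pXn2r R 4 _ _ _ a0 b0)//.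
rewrite -exprM (_ : 10 * 4 = 8 * 5)%N// exprM eighth_root3X8.
have h1 : 0 <= (394 / 100 : R) ^+ 2 <= 311 / 20 by apply/andP; split; lra.
have [h10 h11] := andP h1.
have h2 : ((394 / 100 : R) ^+ 2) ^+ 2 <= (311 / 20) ^+ 2.
  by apply: lerXn2r; [exact: h10|rewrite nnegrE; lra|exact: h11].
rewrite (_ : 4 = 2 * 2)%N// exprM (le_trans h2)//; lra.
Qed.

Lemma grid_sum_growth : exists A, 0 <= A /\
  forall K, grid_sum K <= A * eighth_root3 ^+ (5 * K).
Proof.
have g0 K : 0 <= grid_sum K by apply: sumr_ge0 => i _; exact: grid_weight_ge0.
exists (\sum_(K < 8) grid_sum K).
have A0 : 0 <= \sum_(K < 8) grid_sum K by apply: sumr_ge0.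
split => // K.
have [n] := ubnP K; elim: n K => // n IH K; rewrite ltnS => Kn.
(* Starting from K - 2 = 6 the error 27 / 3 ^ (K - 2) fits between 35/9 and
   3 ^ (5/4); the smaller indices only affect the constant. *)
have [K8|K8] := ltnP K 8.
  apply: (@le_trans _ _ (\sum_(K < 8) grid_sum K)).
    by rewrite (bigD1 (Ordinal K8))//= lerDl; apply: sumr_ge0.
  by rewrite ler_peMr// eighth_root3X_ge1.
case: K K8 Kn => // -[//|K] K8 Kn.
apply: (le_trans (grid_sum_step K)).
have IHK : grid_sum K <= (\sum_(K < 8) grid_sum K) * eighth_root3 ^+ (5 * K).
  by apply: IH; rewrite (leq_trans _ Kn).
have h : 35 / 9 + 27 / 3 ^+ K <= eighth_root3 ^+ 10.
  apply: le_trans eighth_root3X10.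
  have : (729 : R) <= 3 ^+ K.
    rewrite -(natrX _ 3 K) ler_nat (_ : 729 = 3 ^ 6)%N// leq_exp2l//.
  move=> h; have : 27 / 3 ^+ K <= 38 / 1000 :> R.
    rewrite ler_pdivrMr; last by rewrite exprn_gt0.
    lra.
  lra.
rewrite (_ : 5 * K.+2 = 10 + 5 * K)%N; last by rewrite !mulnS addnA.
rewrite exprD mulrCA; exact: ler_pM.
Qed.

End trigonometric_sums.

(** * Mean size of the Fourier coefficients *)

Section coefficient_sums.
Context (R : realType) (mu : probability (measurableTypeR R) R).
Hypothesis hmu : is_cantor_measure mu.
Local Notation pi := (@pi R).

Definition coef_abs (n : nat) : R := modc (fourier_coef (rescaled_measure mu) n).

Definition grid_index (n : nat) : nat := Num.truncn (n%:R / (2 * pi)).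

Let pi_gt0 : 0 < pi. Proof. exact: pi_gt0. Qed.
Let pi2_gt0 : 0 < 2 * pi. Proof. by rewrite mulr_gt0. Qed.

Lemma coef_abs_le_grid K n : coef_abs n <= 2 * grid_weight R K (grid_index n).
Proof.
apply: (le_trans (modc_fourier_coef_le hmu K n)); rewrite ler_wpM2l//.
apply: ler_prod => j _; rewrite normr_ge0 /=.
set J := j.+1; apply: (le_trans (abs_cos_near _ (pi * (grid_index n)%:R / 3 ^+ J))).
rewrite /cantor_factor lerD2l.
have J0 : 0 < (3 : R) ^+ J by rewrite exprn_gt0.
have x0 : 0 <= n%:R / (2 * pi) by rewrite divr_ge0// ltW.
have /andP[h1 h2] := Num.Theory.truncn_itv x0.
rewrite -/(grid_index n) in h1 h2.
have h1' : (grid_index n)%:R * (2 * pi) <= n%:R by rewrite -ler_pdivlMr.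
have h2' : n%:R <= (grid_index n)%:R * (2 * pi) + 2 * pi.
  by rewrite -[X in _ + X]mul1r -mulrDl natr1 -ler_pdivrMr// ltW.
rewrite (_ : _ - _ = (n%:R - (grid_index n)%:R * (2 * pi)) / 2 / 3 ^+ J); last first.
  by field; rewrite gt_eqF.
rewrite normrM ger0_norm; last by rewrite divr_ge0// subr_ge0.
rewrite gtr0_norm ?invr_gt0// ler_wpM2r ?invr_ge0 ?(ltW J0)//.
lra.
Qed.

(** Nine exceeds 2 pi, so integers in one residue class mod 9 have distinct
    lattice points; being a power of 3, it also divides the length of the sums. *)
Lemma grid_index_gap m n : (m + 9 <= n)%N -> (grid_index m < grid_index n)%N.
Proof.
move=> mn; rewrite /grid_index Num.Theory.truncn_ge_nat; last first.
  by rewrite divr_ge0// ltW.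
have x0 : 0 <= m%:R / (2 * pi) by rewrite divr_ge0// ltW.
have /andP[h1 _] := Num.Theory.truncn_itv x0.
rewrite -natr1 ler_pdivlMr// mulrDl mul1r.
have p4 : pi < 4 by have := @pihalf_lt2 R; lra.
have : (m%:R + 9 : R) <= n%:R by rewrite -natrD ler_nat.
move: h1; rewrite ler_pdivlMr// => h1; lra.
Qed.

Lemma sum_increasing_le (P : nat -> R) (j : nat -> nat) M T :
  (forall i, 0 <= P i) -> {homo j : m n / (m < n)%N} ->
  (forall m, (m < M)%N -> (j m < T)%N) ->
  \sum_(m < M) P (j m) <= \sum_(i < T) P i.
Proof.
move=> P0 jh; elim: M T => [|M IH] T jT.
  by rewrite big_ord0; apply: sumr_ge0.
have jM : (j M < T)%N by exact: jT.
rewrite big_ord_recr /= -(subnKC jM) big_split_ord /= big_ord_recr /=.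
rewrite -[leLHS]addr0 lerD ?sumr_ge0// lerD2r.
by apply: IH => m mM; apply: jh.
Qed.

Lemma sum_coef_abs_le K :
  \sum_(n < (3 ^ K.+2)%N) coef_abs n <= 18 * grid_sum R K.+2.
Proof.
have e : (3 ^ K.+2 = 9 * 3 ^ K)%N by rewrite -(addn2 K) expnD mulnC.
rewrite e sum_by_blocks exchange_big /=.
rewrite (_ : 18 * _ = \sum_(a < 9) 2 * grid_sum R K.+2); last first.
  by rewrite sumr_const card_ord -[RHS]mulr_natl; ring.
apply: ler_sum => a _.
apply: (@le_trans _ _ (\sum_(b < (3 ^ K)%N)
    2 * grid_weight R K.+2 (grid_index (9 * b + a)))).
  by apply: ler_sum => b _; exact: coef_abs_le_grid.
rewrite -mulr_sumr ler_wpM2l//.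
apply: (@sum_increasing_le (grid_weight R K.+2) (fun b => grid_index (9 * b + a))).
- exact: grid_weight_ge0.
- move=> m n mn; apply: grid_index_gap.
  by rewrite addnAC leq_add2r addnC -mulnS leq_mul2l mn.
- move=> b bK; rewrite /grid_index Num.Theory.truncn_lt_nat; last first.
    by rewrite divr_ge0// ltW.
  rewrite ltr_pdivrMr//.
  have h : (9 * b + a < 3 ^ K.+2)%N.
    rewrite e; apply: (@leq_trans (9 * b.+1)); last by rewrite leq_mul2l.
    by rewrite mulnS addnC ltn_add2r.
  have : ((9 * b + a)%:R : R) < (3 ^ K.+2)%:R by rewrite ltr_nat.
  move=> /lt_le_trans; apply; rewrite ler_peMr//.
  by have := @pi_ge2 R; lra.
Qed.

Lemma coef_abs_ge0 n : 0 <= coef_abs n.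
Proof. exact: modc_ge0. Qed.

Lemma sum_coef_abs_growth : exists A, 0 <= A /\
  forall K, \sum_(n < (3 ^ K)%N) coef_abs n <= A * eighth_root3 R ^+ (5 * K).
Proof.
have [A [A0 hA]] := grid_sum_growth R.
set B := \sum_(n < 9) coef_abs n.
have B0 : 0 <= B by apply: sumr_ge0 => n _; exact: coef_abs_ge0.
exists (18 * A + B); split; first by rewrite addr_ge0// mulr_ge0.
move=> K; rewrite mulrDl.
have r0 n : 0 <= eighth_root3 R ^+ n by rewrite exprn_ge0// eighth_root3_ge0.
have small (N : nat) : (N <= 9)%N -> \sum_(n < N) coef_abs n <= B.
  move=> N9; rewrite /B -(subnKC N9) big_split_ord/= lerDl.
  by apply: sumr_ge0 => n _; exact: coef_abs_ge0.
have low : (3 ^ K <= 9)%N ->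
    \sum_(n < (3 ^ K)%N) coef_abs n <=
      18 * A * eighth_root3 R ^+ (5 * K) + B * eighth_root3 R ^+ (5 * K).
  move=> h; apply: (le_trans (small _ h)).
  rewrite -[leLHS]add0r lerD ?mulr_ge0//.
  by rewrite ler_peMr// eighth_root3X_ge1.
case: K low => [|[|K]] low; [exact: low|exact: low|].
apply: (le_trans (sum_coef_abs_le K)).
rewrite -[leLHS]addr0; apply: lerD; last by rewrite mulr_ge0.
by rewrite -mulrA; apply: ler_wpM2l.
Qed.

Lemma rpow_half_eighth_root3 K : rpow (- (1 / 2)) ((3 ^ K)%:R : R) * eighth_root3 R ^+ (4 * K) = 1.
Proof.
rewrite eighth_root3X /rpow natrX lnXn// -expRD -[RHS]expR0; congr expR.
by rewrite natrM -mulr_natl; field.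
Qed.

(** The triadic block from 3 ^ K to 3 ^ (K + 1) contributes
    3 ^ (- K / 2) * 3 ^ (5 K / 8) = 3 ^ (K / 8), so the last block dominates. *)
Lemma weighted_sum_growth : exists A, 0 <= A /\
  forall K, \sum_(n < (3 ^ K)%N) coef_abs n * rpow (- (1 / 2)) (n%:R : R) <=
    A * eighth_root3 R ^+ K.
Proof.
have [A [A0 hA]] := sum_coef_abs_growth.
have r1 := eighth_root3_gt1 R; have r0 := eighth_root3_ge0 R.
have rr : 0 < eighth_root3 R - 1 by rewrite subr_gt0.
set B := coef_abs 0 + A * eighth_root3 R ^+ 5 / (eighth_root3 R - 1).
have hAr : A * eighth_root3 R ^+ 5 <= B * (eighth_root3 R - 1).
  rewrite /B mulrDl divfK ?gt_eqF// lerDr mulr_ge0 ?coef_abs_ge0// ltW//.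
have hB : 0 <= A * eighth_root3 R ^+ 5 / (eighth_root3 R - 1).
  by rewrite divr_ge0 ?mulr_ge0 ?exprn_ge0// ltW.
exists B; split; first by rewrite /B addr_ge0 ?coef_abs_ge0.
elim=> [|K IH].
  rewrite expn0 big_ord_recl big_ord0 addr0 expr0 mulr1 /B /=.
  by rewrite {1}/rpow ln0// mulr0 expR0 mulr1 lerDl.
have e : (3 ^ K.+1 = 3 ^ K + 2 * 3 ^ K)%N by rewrite expnS mulSn.
rewrite e big_split_ord /=.
have h2 : \sum_(i < (2 * 3 ^ K)%N) coef_abs (3 ^ K + i) *
     rpow (- (1 / 2)) ((3 ^ K + i)%:R : R) <= A * eighth_root3 R ^+ 5 * eighth_root3 R ^+ K.
  apply: (@le_trans _ _ (rpow (- (1 / 2)) ((3 ^ K)%:R : R) *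
      \sum_(n < (3 ^ K.+1)%N) coef_abs n)).
    rewrite e [X in _ <= _ * X]big_split_ord /= mulrDr -[leLHS]add0r lerD//.
      by rewrite mulr_ge0 ?rpow_ge0// sumr_ge0// => n _; exact: coef_abs_ge0.
    rewrite mulr_sumr; apply: ler_sum => i _; rewrite mulrC.
    rewrite ler_wpM2r ?coef_abs_ge0// ler_expR; apply: ler_wnM2l; first by lra.
    rewrite ler_ln ?posrE ?ltr0n ?ler_nat ?leq_addr// ?expn_gt0//.
    by rewrite addn_gt0 expn_gt0.
  apply: (le_trans (ler_wpM2l (rpow_ge0 _ _) (hA K.+1))).
  rewrite (_ : 5 * K.+1 = 5 + K + 4 * K)%N; last by rewrite mulnS -addnA -mulSn.
  rewrite exprD exprD.
  have := rpow_half_eighth_root3 K; set u := rpow _ _; set v := eighth_root3 R ^+ (4 * K) => uv.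
  rewrite (_ : u * _ = A * (eighth_root3 R ^+ 5 * eighth_root3 R ^+ K) * (u * v)); last by ring.
  by rewrite uv mulr1 mulrA.
apply: (le_trans (lerD IH h2)).
rewrite -mulrDl [in leRHS]exprS [leRHS]mulrA; apply: ler_wpM2r; first exact: exprn_ge0.
by move: hAr; rewrite mulrBr mulr1 lerBrDl.
Qed.

End coefficient_sums.

(** * The tail of the Dirichlet series *)

Section tail.
Context (R : realType) (mu : probability (measurableTypeR R) R).
Hypothesis hmu : is_cantor_measure mu.

Definition log_gap (n : nat) : R := ln n.+1%:R - ln n%:R.

Lemma log_gap_ge0 n : (0 < n)%N -> 0 <= log_gap n.
Proof. by move=> n0; rewrite subr_ge0 ler_ln ?posrE ?ltr0n// ler_nat. Qed.

Lemma log_gap_le n : (0 < n)%N -> log_gap n <= n%:R^-1.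
Proof.
move=> n0; have n0' : (0 : R) < n%:R by rewrite ltr0n.
rewrite /log_gap -ln_div ?posrE ?ltr0n// -natr1 mulrDl divff ?gt_eqF// mul1r.
by apply: le_ln1Dx; apply: (lt_trans (ltrN10 _)); rewrite invr_gt0.
Qed.

Lemma log_gap_decr n : (0 < n)%N -> log_gap n.+1 <= log_gap n.
Proof.
move=> n0; have n0' : (0 : R) < n%:R by rewrite ltr0n.
rewrite /log_gap lerBlDr addrAC lerBrDr -!lnM ?posrE ?ltr0n//.
rewrite ler_ln ?posrE ?mulr_gt0 ?ltr0n// -!natr1; nra.
Qed.

(** The ratio of consecutive powers, without the oscillating factor. *)
Definition pow_ratio (s : R[i]) (n : nat) : R[i] := cexp (- s * (log_gap n)%:C).

Lemma cpowS s n : cpow s n.+1%:R = pow_ratio s n * cpow s (n%:R : R).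
Proof.
rewrite /pow_ratio /cpow -cexpD -mulrDr; congr (cexp (_ * _)).
by rewrite -rmorphD/= /log_gap subrK.
Qed.

Lemma decay_cexpB1 (s : R[i]) (u : R) : 0 <= Rep s -> 0 <= u ->
  modc (cexp (- s * u%:C) - 1) <= 2 * modc s * u.
Proof.
move=> s0 u0; have := @cexpB1_le _ (- s) 1 u u0; rewrite modcN mulr1; apply.
move=> v /andP[v0 _]; rewrite cReN -expR0 ler_expR mulrN oppr_le0.
exact: mulr_ge0.
Qed.

Lemma modc_decay (s : R[i]) (u : R) : 0 <= Rep s -> 0 <= u ->
  modc (cexp (- s * u%:C)) <= 1.
Proof.
move=> s0 u0; rewrite modc_cexp -expR0 ler_expR !cReImE/= mulr0 subr0 mulNr.
by rewrite oppr_le0 mulr_ge0.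
Qed.

Lemma pow_ratio_diff s n : 0 <= Rep s -> (0 < n)%N ->
  modc (pow_ratio s n - pow_ratio s n.+1) <=
    2 * modc s * (log_gap n - log_gap n.+1).
Proof.
move=> s0 n0; have d0 : 0 <= log_gap n - log_gap n.+1.
  by rewrite subr_ge0 log_gap_decr.
have -> : pow_ratio s n = pow_ratio s n.+1 *
    cexp (- s * (log_gap n - log_gap n.+1)%:C).
  rewrite /pow_ratio -cexpD -mulrDr; congr (cexp (_ * _)).
  by rewrite -rmorphD/= subrKC.
rewrite -[X in _ - X]mulr1 -mulrBr modcM -[leRHS]mul1r.
apply: ler_pM; rewrite ?modc_ge0//; last exact: decay_cexpB1.
by apply: modc_decay => //; exact: log_gap_ge0.
Qed.

Definition wave_term (x : R) (s : R[i]) (n : nat) : R[i] :=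
  charac n%:R x * cpow s n%:R.

Definition step_ratio (x : R) (s : R[i]) (n : nat) : R[i] :=
  charac 1 x * pow_ratio s n.

Lemma wave_termS x s n :
  wave_term x s n.+1 = step_ratio x s n * wave_term x s n.
Proof.
by rewrite /wave_term /step_ratio cpowS -natr1 characD; ring.
Qed.

Lemma modc_wave_term_le x s n : 0 <= Rep s -> modc (wave_term x s n.+1) <= 1.
Proof.
move=> s0; rewrite /wave_term modcM modc_charac mul1r.
by apply: modc_decay => //; rewrite ln_ge0// ler1n.
Qed.

Lemma step_ratio_far x s n : 0 <= Rep s -> unit_itv x -> (0 < n)%N ->
  4 * modc s <= gap R * n%:R -> gap R / 2 <= modc (step_ratio x s n - 1).
Proof.
move=> s0 xU n0 sn; have n0' : (0 : R) < n%:R by rewrite ltr0n.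
have h1 := @gap_le R 1 x (or_introl erefl) xU.
have h2 : modc (pow_ratio s n - 1) <= gap R / 2.
  apply: (le_trans (decay_cexpB1 s0 (log_gap_ge0 n0))).
  apply: (@le_trans _ _ (2 * modc s / n%:R)).
    by rewrite ler_wpM2l ?mulr_ge0 ?modc_ge0// log_gap_le.
  rewrite ler_pdivrMr//; lra.
have -> : step_ratio x s n - 1 =
    (charac 1 x - 1) - charac 1 x * (1 - pow_ratio s n).
  by rewrite /step_ratio; ring.
apply: (le_trans _ (modc_tri _ _)).
rewrite modcM modc_charac mul1r (modcBC 1); lra.
Qed.

Definition step_inv x s n : R[i] := (step_ratio x s n - 1)^-1.

Lemma partial_wave_sum x s N M :
  (forall m, step_ratio x s (N + m) - 1 != 0) ->
  \sum_(m < M) wave_term x s (N + m) =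
    step_inv x s (N + M) * wave_term x s (N + M) -
    step_inv x s N * wave_term x s N +
    \sum_(m < M) (step_inv x s (N + m) - step_inv x s (N + m).+1) *
       wave_term x s (N + m).+1.
Proof.
move=> nz; elim: M => [|M IH]; first by rewrite !big_ord0 addn0 subrr addr0.
have h : wave_term x s (N + M) =
    step_inv x s (N + M) * (wave_term x s (N + M).+1 - wave_term x s (N + M)).
  by rewrite wave_termS -{3}[wave_term x s (N + M)]mul1r -mulrBl mulKf.
rewrite !big_ord_recr /= IH addnS [X in _ + X = _]h; ring.
Qed.

(** The Kusmin-Landau argument.  A term is the difference of two consecutive
    terms divided by r - 1, with r their ratio.  Once n exceeds a multiple of |s|
    the ratio is far from 1, and its total variation is at most
    2 |s| (log (N + 1) - log N), so summation by parts leaves a bounded sum. *)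
Lemma wave_sum_le x s N M : 0 <= Rep s -> unit_itv x -> (0 < N)%N ->
  4 * modc s <= gap R * N%:R ->
  modc (\sum_(m < M) wave_term x s (N + m)) <= 6 / gap R.
Proof.
move=> s0 xU N0 sN; have g0 := gap_gt0 R.
have far m : gap R / 2 <= modc (step_ratio x s (N + m) - 1).
  apply: step_ratio_far => //; first by rewrite addn_gt0 N0.
  by apply: (le_trans sN); rewrite ler_wpM2l ?(ltW g0)// ler_nat leq_addr.
have nz m : step_ratio x s (N + m) - 1 != 0.
  apply/eqP => z; have := far m; rewrite z modc0 leNgt divr_gt0//.
have inv m : modc (step_inv x s (N + m)) <= 2 / gap R.
  rewrite modcV -[leRHS]invrK invf_div lef_pV2 ?posrE ?divr_gt0//.
  by apply: lt_le_trans (far m); rewrite divr_gt0.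
have wle m : modc (wave_term x s (N + m)) <= 1.
  by case: N N0 {sN far nz inv} => // N _; exact: modc_wave_term_le.
have dinv m : modc (step_inv x s (N + m) - step_inv x s (N + m).+1) <=
    (2 / gap R) ^+ 2 * (2 * modc s) * (log_gap (N + m) - log_gap (N + m).+1).
  have -> : step_inv x s (N + m) - step_inv x s (N + m).+1 =
     step_inv x s (N + m) * step_inv x s (N + m).+1 *
     - (charac 1 x * (pow_ratio s (N + m) - pow_ratio s (N + m).+1)).
    have n1 := nz m; have := nz m.+1; rewrite addnS => n2.
    have -> : charac 1 x * (pow_ratio s (N + m) - pow_ratio s (N + m).+1) =
        (step_ratio x s (N + m) - 1) - (step_ratio x s (N + m).+1 - 1).
      by rewrite /step_ratio; ring.
    by rewrite /step_inv; field; rewrite n1 n2.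
  have i2 := inv m.+1; rewrite addnS in i2.
  rewrite !modcM modcN modcM modc_charac mul1r -[leRHS]mulrA.
  apply: ler_pM; rewrite ?mulr_ge0 ?modc_ge0//.
    by rewrite expr2 ler_pM ?modc_ge0.
  by apply: pow_ratio_diff => //; rewrite addn_gt0 N0.
rewrite (partial_wave_sum M nz); apply: (le_trans (modcD _ _)).
have tele : \sum_(m < M) (log_gap (N + m) - log_gap (N + m).+1) <= N%:R^-1.
  have -> : \sum_(m < M) (log_gap (N + m) - log_gap (N + m).+1) =
      log_gap N - log_gap (N + M).
    elim: M => [|M IH]; first by rewrite big_ord0 addn0 subrr.
    by rewrite big_ord_recr /= IH addnS; ring.
  apply: (le_trans _ (log_gap_le N0)).
  by rewrite lerBlDr lerDl log_gap_ge0// addn_gt0 N0.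
have h1 : modc (step_inv x s (N + M) * wave_term x s (N + M) -
    step_inv x s N * wave_term x s N) <= 4 / gap R.
  apply: (le_trans (modcB _ _)).
  rewrite (modcM (step_inv x s (N + M))) (modcM (step_inv x s N)).
  have e m : modc (step_inv x s (N + m)) * modc (wave_term x s (N + m)) <= 2 / gap R.
    by rewrite -[leRHS]mulr1 ler_pM ?modc_ge0.
  have := e 0%N; rewrite addn0 => e0; have eM := e M.
  apply: (le_trans (lerD eM e0)); rewrite le_eqVlt; apply/orP; left; apply/eqP.
  ring.
have h2 : modc (\sum_(m < M) (step_inv x s (N + m) - step_inv x s (N + m).+1) *
       wave_term x s (N + m).+1) <= 2 / gap R.
  apply: (le_trans (modc_sum _ _ _)).
  apply: (@le_trans _ _ (\sum_(m < M) (2 / gap R) ^+ 2 * (2 * modc s) *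
      (log_gap (N + m) - log_gap (N + m).+1))).
    apply: ler_sum => m _; rewrite modcM -[leRHS]mulr1.
    by rewrite ler_pM ?modc_ge0 ?dinv// -addnS wle.
  rewrite -mulr_sumr; apply: (@le_trans _ _
     ((2 / gap R) ^+ 2 * (2 * modc s) * N%:R^-1)).
    by rewrite ler_wpM2l// mulr_ge0 ?sqr_ge0// mulr_ge0// modc_ge0.
  rewrite ler_pdivrMr ?ltr0n//.
  rewrite (_ : 2 / gap R * N%:R = (2 / gap R) ^+ 2 * (gap R * N%:R / 2)); last first.
    by field; rewrite gt_eqF.
  rewrite ler_wpM2l ?sqr_ge0//; lra.
apply: (le_trans (lerD h1 h2)); rewrite le_eqVlt; apply/orP; left; apply/eqP.
ring.
Qed.

Lemma dirichlet_tail_le s N M : 0 <= Rep s -> (0 < N)%N ->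
  4 * modc s <= gap R * N%:R ->
  modc (\sum_(m < M) fourier_coef (rescaled_measure mu) (N + m) *
          cpow s (N + m)%:R) <= 12 / gap R.
Proof.
move=> s0 N0 sN.
have [h1 h2] := @cintegral_sum R mu 'I_M (index_enum _)
  (fun m => cpow s (N + m)%:R) (fun m => charac (N + m)%:R)
  (fun m => bounded_meas_charac _).
have e x : \sum_(m < M) cpow s (N + m)%:R * charac (N + m)%:R x =
    \sum_(m < M) wave_term x s (N + m).
  by apply: eq_bigr => m _; rewrite mulrC.
rewrite (_ : \sum_(m < M) _ =
    cintegral mu (fun x => \sum_(m < M) cpow s (N + m)%:R * charac (N + m)%:R x)).
  rewrite (_ : 12 / gap R = 2 * (6 / gap R)); last by ring.
  apply: (modc_cintegral_le hmu h1) => x xU; rewrite e.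
  exact: wave_sum_le.
by rewrite h2; apply: eq_bigr => m _; rewrite (fourier_coefE hmu) mulrC.
Qed.

End tail.

(** * The bound on the critical line *)

Section order_bound.
Context (R : realType) (mu : probability (measurableTypeR R) R).
Hypothesis hmu : is_cantor_measure mu.

Definition cantor_L : R[i] -> R[i] := continuation (smoothed_coef mu).

Lemma cantor_L_cvg s : 0 < Rep s ->
  ccvg (fun M => \sum_(m < M) fourier_coef (rescaled_measure mu) m.+1 *
                   cpow s m.+1%:R) (cantor_L s).
Proof.
move=> s0; have := continuation_cvg (smoothed_coef_bounded hmu)
  (smoothed_coef_rec mu) s0.
congr (ccvg _ _); apply/funext => M; apply: eq_bigr => m _.
by rewrite (smoothed_coef0 hmu).
Qed.

Lemma cantor_L_continuation :
  entire_continuation (fourier_coef (rescaled_measure mu)) cantor_L.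
Proof.
split; first exact: (continuation_entire (smoothed_coef_bounded hmu)
  (smoothed_coef_rec mu)).
move=> s s1; have s0 : 0 < Rep s by apply: lt_trans s1.
rewrite (_ : series _ = (fun M => \sum_(m < M)
    fourier_coef (rescaled_measure mu) m.+1 * cpow s m.+1%:R)).
  exact: ccvgP (cantor_L_cvg s0).
by apply/funext => M; rewrite /series/= big_mkord.
Qed.

(** The cut at 3 ^ K is free as long as it is at least a multiple of |s|; the
    best choice is made in [cantor_L_order]. *)
Lemma cantor_L_half_le : exists A, 0 <= A /\ forall K (t : R),
  4 * modc (1 / 2 +i* t) <= gap R * (3 ^ K)%:R ->
  modc (cantor_L (1 / 2 +i* t)) <= A * eighth_root3 R ^+ K.+1 + 12 / gap R.
Proof.
have [A [A0 hA]] := weighted_sum_growth hmu.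
exists A; split => // K t ht; set s : R[i] := 1 / 2 +i* t.
have s0 : 0 < Rep s by rewrite /s/=; lra.
apply: (ccvg_le (N := (3 ^ K)%N) (cantor_L_cvg s0)) => M KM.
rewrite -(subnKC KM) big_split_ord /=; apply: (le_trans (modcD _ _)).
apply: lerD.
  apply: (le_trans (modc_sum _ _ _)); apply: (le_trans _ (hA K.+1)).
  pose F (n : nat) := coef_abs mu n * rpow (- (1 / 2)) (n%:R : R).
  have F0 n : 0 <= F n by rewrite mulr_ge0 ?coef_abs_ge0 ?rpow_ge0.
  rewrite (eq_bigr (fun m : 'I_(3 ^ K) => F m.+1)).
    apply: (@sum_increasing_le _ F succn _ _ F0) => // m mK.
    by apply: (leq_ltn_trans mK); rewrite ltn_exp2l.
  by move=> m _; rewrite modcM modc_cpow.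
have N0 : (0 < (3 ^ K).+1)%N by [].
have := @dirichlet_tail_le _ _ hmu s (3 ^ K).+1 (M - 3 ^ K) (ltW s0) N0.
apply; apply: (le_trans ht); rewrite ler_wpM2l ?(ltW (gap_gt0 R))//.
by rewrite ler_nat.
Qed.

Lemma pow3_between (y : R) : 1 <= y -> exists K : nat,
  y <= (3 ^ K)%:R /\ eighth_root3 R ^+ K <= eighth_root3 R * expR (ln y / 8).
Proof.
move=> y1; have y0 : 0 < y by apply: lt_le_trans y1.
have l3 : 0 < ln (3 : R) by rewrite ln_gt0// ltr1n.
have q0 : 0 <= ln y / ln 3 by rewrite divr_ge0 ?(ltW l3)// ln_ge0.
have /andP[h1 h2] := Num.Theory.truncn_itv q0.
set k := Num.truncn _ in h1 h2; exists k.+1; split.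
  rewrite -ler_ln ?posrE ?ltr0n ?expn_gt0// natrX lnXn// -[leRHS]mulr_natl.
  by rewrite -ler_pdivrMr// ltW.
rewrite exprS ler_wpM2l ?eighth_root3_ge0// eighth_root3X ler_expR mulrA ler_wpM2r//.
by rewrite -ler_pdivlMr.
Qed.

Lemma cantor_L_order : exists C T : R, forall t : R, T <= `|t| ->
  modc (cantor_L (1 / 2 +i* t)) <= C * `|t| `^ (1 / 8).
Proof.
have [A [A0 hA]] := cantor_L_half_le; have g0 := gap_gt0 R.
have r0 := eighth_root3_ge0 R.
have g1 : gap R <= 2.
  by have := @cos_geN1 R (1 / 2); rewrite /gap; lra.
exists (A * eighth_root3 R ^+ 2 * expR (ln (8 / gap R) / 8) + 12 / gap R), 1 => t t1.
have t0 : 0 < `|t| by apply: lt_le_trans t1.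
(* |s| <= 2 |t|, so cutting beyond y meets the condition on the tail. *)
set y := 8 / gap R * `|t|.
have c1 : 1 <= 8 / gap R by rewrite ler_pdivlMr// mul1r; lra.
have c0 : 0 < 8 / gap R by rewrite divr_gt0.
have y1 : 1 <= y by rewrite -[leLHS]mulr1; apply: ler_pM.
have [K [hK1 hK2]] := pow3_between y1.
have sle : 4 * modc (1 / 2 +i* t : R[i]) <= gap R * (3 ^ K)%:R.
  apply: (@le_trans _ _ (gap R * y)); last by rewrite ler_wpM2l// ltW.
  rewrite /y mulrA mulrCA divff ?gt_eqF// mulr1.
  have := modc_le_ReIm (1 / 2 +i* t : R[i]); rewrite /= ger0_norm; lra.
apply: (le_trans (hA K t sle)).
have pE : `|t| `^ (1 / 8) = expR (ln `|t| / 8).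
  by rewrite /powR gt_eqF// mulrC mul1r.
have yE : expR (ln y / 8) = expR (ln (8 / gap R) / 8) * `|t| `^ (1 / 8).
  by rewrite pE /y lnM ?posrE// mulrDl expRD.
rewrite [leRHS]mulrDl; apply: lerD.
  rewrite (exprS _ K) (expr2 (eighth_root3 R)) -!mulrA !ler_wpM2l// -yE.
  exact: hK2.
rewrite ler_peMr ?divr_ge0 ?(ltW g0)// pE -expR0 ler_expR divr_ge0// ln_ge0//.
Qed.

End order_bound.

Local Close Scope complex_scope.
Unset Implicit Arguments.

Theorem theorem9p39 (R : realType)
    (mu : probability (measurableTypeR R) R) (hmu : is_cantor_measure mu) :
  exists L : R[i] -> R[i],
    entire_continuation (fourier_coef (rescaled_measure mu)) L /\
    (order_function L (1 / 2) <= (1 / 8)%:E)%E.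
Proof.
exists (cantor_L mu); split; first exact: cantor_L_continuation.
have [C [T hCT]] := cantor_L_order hmu.
apply: ereal_inf_lbound; exists (1 / 8) => //.
by split; [rewrite divr_ge0|exists C, T].
Qed.
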